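(* Let $F\in\mathbb{D}^{1,2}$ with $\mathbb{E}[F]=0$, $\operatorname{Var}(F)=1$, such that $Ff_z(F)+\mathbf 1\{F>z\}\in\mathbb{D}^{1,2}$ for all $z\in\mathbb{R}$ and $u:=\big(\frac{1}{\sqrt{p_kq_k}}D_kF\,|D_kL^{-1}F|\big)_{k\in\mathbb{N}}\in\operatorname{Dom}(\delta)$. Assume there exist a constant $A>0$ and increasing functions $\gamma_1,\gamma_2$ such that $\mathbb{E}[e^{tF}]<\infty$, $$\mathbb{E}\big[|1-\langle DF,-DL^{-1}F\rangle|\,e^{tF}\big]\le\gamma_1(t)\,\mathbb{E}[e^{tF}]\quad\text{and}\quad \mathbb{E}\big[|\delta(u)|\,e^{tF}\big]\le\gamma_2(t)\,\mathbb{E}[e^{tF}]$$ for all $0\le t\le A$. Then for all $0\le z\le A$, $$\Big|\frac{\mathbb{P}(F>z)}{1-\Phi(z)}-1\Big|\le 25\,e^{\frac{z^2}{2}(\gamma_1(z)+\gamma_2(z))}(1+z^2)\big(\gamma_1(z)+\gamma_2(z)\big).$$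
   Context: $X=(X_k)_{k\in\mathbb{N}}$ are independent Rademacher variables with $\mathbb{P}(X_k=1)=p_k\in(0,1)$, $\mathbb{P}(X_k=-1)=q_k=1-p_k$; $Y_k=(X_k-p_k+q_k)/(2\sqrt{p_kq_k})$. For $F=f(X)\in L^2(\Omega,\sigma(X),\mathbb{P})$, $F_k^\pm$ is $f$ evaluated with $X_k$ replaced by $\pm1$, and $D_kF:=\sqrt{p_kq_k}(F_k^+-F_k^-)$, $DF=(D_kF)_k$. $\mathbb{D}^{1,2}=\{F\in L^2:\mathbb{E}\sum_k(D_kF)^2<\infty\}$. $\delta$ is the adjoint of $D$: $\mathbb{E}[\langle DG,u\rangle]=\mathbb{E}[G\delta(u)]$ for all $G\in\mathbb{D}^{1,2}$, $\langle a,b\rangle=\sum_ka_kb_k$. With the chaos expansion $F=\mathbb{E}F+\sum_{n\ge1}J_n(f_n)$, $J_n(f_n)=\sum f_n(i_1,\dots,i_n)Y_{i_1}\cdots Y_{i_n}\mathbf 1\{i_j\ne i_k, j\neq k\}$, $L^{-1}F:=-\sum_{n\ge1}\frac1nJ_n(f_n)$. $\Phi$, $p(w)=e^{-w^2/2}/\sqrt{2\pi}$ are the standard normal distribution function and density; $f_z(w)=\Phi(w)(1-\Phi(z))/p(w)$ for $w\le z$, $f_z(w)=\Phi(z)(1-\Phi(w))/p(w)$ for $w>z$. *)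

(* Defs.v *)
From HB Require Import structures.
From mathcomp Require Import all_boot all_order all_algebra.
From mathcomp Require Import all_classical all_reals all_analysis.
Set Implicit Arguments. Unset Strict Implicit. Unset Printing Implicit Defensive.
Import Order.TTheory GRing.Theory Num.Theory.
Import numFieldNormedType.Exports.
Local Open Scope classical_set_scope.
Local Open Scope ring_scope.

Definition cyl (R : realType) : set (set (nat -> R)) :=
  [set A | exists k (B : set R), measurable B /\ A = (fun w => w k) @^-1` B].

Definition gmeasurable (R : realType) (g : (nat -> R) -> R) : Prop :=
  forall B : set R, measurable B -> <<s (@cyl R) >> (g @^-1` B).

Definition rademacher_family (R : realType) (d : measure_display)
  (T : measurableType d) (P : probability T R) (X : nat -> T -> R)
  (p : nat -> R) : Prop :=
  [/\ forall k, 0 < p k < 1,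
      forall k, measurable_fun setT (X k),
      forall k, P (X k @^-1` [set 1]) = (p k)%:E,
      forall k, P (X k @^-1` [set -1]) = (1 - p k)%:E &
      forall (s : seq nat) (e : nat -> R), uniq s ->
        P (\bigcap_(k in [set k | k \in s]) (X k @^-1` [set e k])) =
        (\prod_(k <- s) fine (P (X k @^-1` [set e k])))%:E].

Definition q_ (R : realType) (p : nat -> R) k : R := 1 - p k.

Definition Xvec (R : realType) (T : Type) (X : nat -> T -> R) (w : T) : nat -> R :=
  fun k => X k w.

Definition rv (R : realType) (T : Type) (X : nat -> T -> R) (g : (nat -> R) -> R) : T -> R :=
  fun w => g (Xvec X w).

Definition upd (R : realType) (v : nat -> R) (k : nat) (x : R) : nat -> R :=
  fun j => if j == k then x else v j.

Definition Dk (R : realType) (T : Type) (X : nat -> T -> R) (p : nat -> R)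
  (g : (nat -> R) -> R) (k : nat) : T -> R :=
  fun w => Num.sqrt (p k * q_ p k) *
           (g (upd (Xvec X w) k 1) - g (upd (Xvec X w) k (-1))).

Definition Yk (R : realType) (T : Type) (X : nat -> T -> R) (p : nat -> R)
  (k : nat) : T -> R :=
  fun w => (X k w - p k + q_ p k) / (2 * Num.sqrt (p k * q_ p k)).

Definition inner (R : realType) (T : Type) (a b : nat -> T -> R) : T -> R :=
  fun w => limn (fun n => \sum_(0 <= k < n) (a k w * b k w)).

Definition L2 (R : realType) (d : measure_display) (T : measurableType d)
  (P : probability T R) (h : T -> R) : Prop :=
  measurable_fun setT h /\ (\int[P]_x ((h x) ^+ 2)%:E < +oo)%E.

Definition D12 (R : realType) (d : measure_display) (T : measurableType d)
  (P : probability T R) (X : nat -> T -> R) (p : nat -> R)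
  (g : (nat -> R) -> R) : Prop :=
  [/\ gmeasurable g, L2 P (rv X g) &
      (\int[P]_x (\sum_(0 <= k <oo) ((Dk X p g k x) ^+ 2)%:E)%E < +oo)%E].

Definition is_delta (R : realType) (d : measure_display) (T : measurableType d)
  (P : probability T R) (X : nat -> T -> R) (p : nat -> R)
  (u : nat -> T -> R) (du : T -> R) : Prop :=
  [/\ forall k, measurable_fun setT (u k),
      (\int[P]_x (\sum_(0 <= k <oo) ((u k x) ^+ 2)%:E)%E < +oo)%E,
      L2 P du &
      forall g, D12 P X p g ->
        (\int[P]_x (inner (Dk X p g) u x)%:E =
         \int[P]_x (rv X g x * du x)%:E)%E].

(* truncated multiple stochastic integral:
   J_n^N(f_n) = sum over pairwise distinct i_1..i_n < N of
                f_n(i_1,..,i_n) Y_{i_1} ... Y_{i_n} *)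
Definition Jn (R : realType) (T : Type) (X : nat -> T -> R) (p : nat -> R)
  (n N : nat) (fn : seq nat -> R) : T -> R :=
  fun w => \sum_(t : n.-tuple 'I_N | uniq t)
             fn (map val t) * \prod_(i <- t) Yk X p (val i) w.

Definition L2cvg (R : realType) (d : measure_display) (T : measurableType d)
  (P : probability T R) (G : nat -> T -> R) (H : T -> R) : Prop :=
  ((fun N => (\int[P]_x (((G N x - H x) ^+ 2)%:E))%E) @ \oo --> 0%E).

Definition chaos_expansion (R : realType) (d : measure_display) (T : measurableType d)
  (P : probability T R) (X : nat -> T -> R) (p : nat -> R)
  (F : T -> R) (fs : nat -> seq nat -> R) : Prop :=
  L2cvg P (fun N w => fine (\int[P]_x (F x)%:E)%E +
                      \sum_(1 <= n < N.+1) Jn X p n N (fs n) w) F.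

Definition is_Linv (R : realType) (d : measure_display) (T : measurableType d)
  (P : probability T R) (X : nat -> T -> R) (p : nat -> R)
  (f G : (nat -> R) -> R) : Prop :=
  gmeasurable G /\
  exists fs : nat -> seq nat -> R,
    chaos_expansion P X p (rv X f) fs /\
    L2cvg P (fun N w => - \sum_(1 <= n < N.+1) (n%:R)^-1 * Jn X p n N (fs n) w)
            (rv X G).

Definition gpdf (R : realType) (w : R) : R :=
  expR (- (w ^+ 2) / 2) / Num.sqrt (2 * pi).

Definition Phi (R : realType) (z : R) : R :=
  fine (\int[@lebesgue_measure R]_(x in `]-oo, z]) (gpdf x)%:E)%E.

Definition fz (R : realType) (z w : R) : R :=
  if w <= z then Phi w * (1 - Phi z) / gpdf w
  else Phi z * (1 - Phi w) / gpdf w.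

(* Main.v *)
(** Put [c = 1 - Phi z], and let [f = fz z] be the solution of the Stein equation, so
    that [f' w - w f w = c - 1{w > z}] and [c - P(F > z) = E[f'(F) - F f(F)]].
    Integration by parts gives [E[F f(F)] = E<D f(F), - D L^-1 F>].  With
    [h w = w f w + 1{w > z}] one has [|f' b - f' a| <= h b - h a] for [a <= b]
    ([w f w] is nondecreasing), so the chain rule remainder
    [D_k f(F) - f'(F) D_k F] is at most [D_k F D_k h(F) / sqrt(p_k q_k)] in absolute
    value, and the duality between [D] and [delta] yields
    [|c - P(F > z)| <= E[|f'(F)| |1 - <DF, - D L^-1 F>|] + E[h(F) delta(u)]].
    Both [|f'|] and [|h|] are bounded by [c] times a combination of the functions
    [exp(t w - t^2/2)], [0 <= t <= z], of total mass at most [25 (1 + z^2)], and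
    [E[exp(t F)] <= exp((1 + gamma1 t + gamma2 t) t^2/2)] because the same remainder
    estimate, applied to [exp(t w)] continued linearly beyond a level tending to
    infinity, bounds [E[F exp(t F)]] by [t (1 + gamma1 t + gamma2 t) E[exp(t F)]].

    Integration by parts holds because resampling the k-th coordinate gives
    [E[D_k H D_k U] = E[H Y_k D_k U]], while [\sum_k Y_k D_k] multiplies the n-th
    chaos by [n]; it passes to the limit since the truncations of [L^-1 F] have
    bounded energy [\sum_k E[(D_k U)^2] = - E[S U]]. *)

Require Import Defs.
From HB Require Import structures.
From mathcomp Require Import all_boot all_order all_algebra.
From mathcomp Require Import all_classical all_reals all_analysis measurable_realfun.
From mathcomp Require Import ring lra.
Import Order.TTheory GRing.Theory Num.Theory.
Import numFieldNormedType.Exports.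
Local Open Scope classical_set_scope.
Local Open Scope ring_scope.
Set Implicit Arguments.
Unset Strict Implicit.
Unset Printing Implicit Defensive.

(** * Gaussian tail estimates *)

Section gauss.
Context {R : realType}.
Implicit Types w x y z a b : R.

(** The error is relative to [1 - Phi z], so every estimate must keep this factor; that is the
    obstacle. On [[0, z]] the function [f'] may be of size [(1 - Phi z) w exp(w^2/2)], while the
    hypotheses control [exp(t F)] for one [t] at a time and not [exp(F^2/2)]. Cutting [[0, z]] into
    cells of length 1 resolves this: on a cell with right end [j], [exp(w^2/2)] is at most
    [exp(1/2) exp(j w - j^2/2)], an exponential with a single admissible parameter. About [z] cells
    with mass proportional to [j] produce the factor [1 + z^2]; 25 absorbs [sqrt(2 pi)], [exp(1/2)]
    and the region beyond [z].

    Two objects are out of direct reach. [exp(t F)] need not lie in [D12]; its linear continuation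
    is Lipschitz together with its slope, which puts both into [D12]. [L^-1 F] is given as an L2
    limit of truncations, so the square-summability of [D L^-1 F] has to be proved before
    [<DF, - D L^-1 F>] is known to converge. *)

Lemma gpdf_normal_pdf w : gpdf w = normal_pdf 0 1 w.
Proof.
rewrite normal_pdfE ?oner_eq0// /normal_peak /normal_fun /gpdf.
by rewrite expr1n subr0 mul1r mulrC -(mulr_natl pi).
Qed.

Lemma gpdf_gt0 w : 0 < gpdf w.
Proof. by rewrite divr_gt0 ?expR_gt0// sqrtr_gt0 mulr_gt0// pi_gt0. Qed.

Lemma gpdfN w : gpdf (- w) = gpdf w.
Proof. by rewrite /gpdf sqrrN. Qed.

Lemma integrable_gpdf :
  (@lebesgue_measure R).-integrable setT (EFin \o @gpdf R).
Proof.
apply: eq_integrable (integrable_normal_pdf 0 1) => //= w _.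
by rewrite gpdf_normal_pdf.
Qed.

Lemma continuous_gpdf : continuous (@gpdf R).
Proof.
rewrite (_ : @gpdf R = normal_pdf 0 1); last first.
  by apply/funext => w; rewrite gpdf_normal_pdf.
by apply: continuous_normal_pdf; rewrite oner_eq0.
Qed.

#[global] Instance is_derive_Phi w : is_derive w (1:R) (@Phi R) (gpdf w).
Proof.
have ltw : w < w + 1 by rewrite ltrDl.
have ig : (@lebesgue_measure R).-integrable [set` Interval -oo%O (BRight (w + 1))]
    (EFin \o @gpdf R).
  exact: integrableS (@integrable_gpdf).
have [dP <-] := continuous_FTC1 ltw ig (ltNyr _) (@continuous_gpdf w).
by split; [exact: dP|rewrite -derive1E].
Qed.

#[global] Instance is_derive_gpdf w :
  is_derive w (1:R) (@gpdf R) (- w * gpdf w).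
Proof.
have H : is_derive w (1:R) (expR \o (fun v => - (v ^+ 2) / 2))
    (expR (- (w ^+ 2) / 2) * (- w)).
  apply: is_derive1_comp.
  apply: is_derive_eq => //.
  by rewrite /GRing.scale /=; field.
rewrite [X in is_derive _ _ X](_ : _ = (Num.sqrt (2 * pi))^-1 *:
   (expR \o (fun v => - (v ^+ 2) / 2))); last first.
  by apply/funext => v; rewrite /gpdf /= [RHS]mulrC.
apply: is_derive_eq.
by rewrite [RHS]mulrC /gpdf [RHS]mulrAC [RHS]mulrC.
Qed.

(** The identity seen as a random variable under the standard normal law: [Phi] is its distribution
    function, so the limits of [Phi] at both infinities are those of a [cdf]. *)
Let idTR : measurableTypeR R -> R := idfun.

#[local] HB.instance Definition _ :=
  @isMeasurableFun.Build _ _ _ _ idTR (@measurable_id _ _ setT).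

Let normal_id : {RV (normal_prob 0 1 : probability _ R) >-> R} := idTR.

Let cdf_Phi : cdf normal_id = EFin \o @Phi R.
Proof.
apply/funext => w; rewrite /cdf /distribution /pushforward /= /Phi fineK.
  by apply: eq_integral => x _; rewrite gpdf_normal_pdf.
apply: integrable_fin_num => //; exact: integrableS (@integrable_gpdf).
Qed.

Lemma cvg_Phi_y : Phi x @[x --> +oo] --> (1 : R).
Proof. by have := cvg_cdfy1 normal_id; rewrite cdf_Phi => /fine_cvgP[]. Qed.

Lemma cvg_Phi_Ny : Phi x @[x --> -oo] --> (0 : R).
Proof. by have := cvg_cdfNy0 normal_id; rewrite cdf_Phi => /fine_cvgP[]. Qed.

Lemma is_derive_const_eq (r : R -> R) x y :
  (forall w, is_derive w 1 r 0) -> r x = r y.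
Proof.
wlog xy : x y / x <= y.
  by move=> H dr; have [/H->|/ltW/H->] := leP x y.
move=> dr.
have [|c _] := @MVT_segment _ r (cst 0) x y xy (fun w _ => dr w).
  apply: continuous_subspaceT => w.
  by apply: differentiable_continuous; apply/derivable1_diffP.
by rewrite /cst mul0r => /eqP; rewrite subr_eq0 => /eqP.
Qed.

(** [Phi x + Phi (- x)] has derivative zero because [gpdf] is even, and it tends to 1 as [x]
    grows. *)
Lemma PhiN w : Phi (- w) = 1 - Phi w.
Proof.
have PN x : is_derive x 1 (fun y => Phi (- y) : R) (- gpdf x).
  have H : is_derive x 1 (@Phi R \o -%R) (gpdf (- x) * -1).
    exact: is_derive1_comp.
  by rewrite gpdfN mulrN1 in H.
have D x : is_derive x 1 (fun y => Phi y + Phi (- y)  : R) 0.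
  rewrite -(subrr (gpdf x)); exact: is_deriveD.
have E x : Phi x + Phi (- x) = Phi w + Phi (- w) :> R.
  exact: (is_derive_const_eq (r := fun y => Phi y + Phi (- y))).
apply/eqP; rewrite eq_sym subr_eq addrC eq_sym; apply/eqP.
have : Phi x + Phi (- x) @[x --> +oo] --> (1 + 0 : R).
  apply: cvgD; first exact: cvg_Phi_y.
  apply: (cvg_comp (fun x : R => - x) _ _ cvg_Phi_Ny).
  by rewrite ninfty; exact: cvg_id.
rewrite addr0 (_ : (fun x => _) = cst (Phi w + Phi (- w))); last first.
  by apply/funext => x; rewrite E.
by move=> H; apply: (cvg_unique _ (@cvg_cst _ _ _ _ _) H).
Qed.

Lemma nonincreasing_cvg0_ge0 (r dr : R -> R) x :
  (forall y, x <= y -> is_derive y 1 r (dr y)) ->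
  (forall y, x <= y -> dr y <= 0) -> r y @[y --> +oo] --> (0 : R) -> 0 <= r x.
Proof.
move=> dr_ dr0 r0.
rewrite leNgt; apply/negP => rx0.
have A : \forall y \near +oo, r x < r y by exact: (cvgr_gt 0).
near (pinfty_nbhs R) => y.
have xy : x < y by near: y; apply: nbhs_pinfty_gt; exact: num_real.
have ry : r x < r y by near: y.
have [||c] := @MVT_segment _ r dr x y (ltW xy).
- by move=> z; rewrite in_itv/= => /andP[/ltW/dr_].
- apply: derivable_within_continuous => z.
  by rewrite in_itv/= => /andP[/dr_[dr0y _] _]; exact: dr0y.
rewrite in_itv/= => /andP[xc cy] E.
have : dr c * (y - x) <= 0.
  by rewrite mulr_le0_ge0 ?subr_ge0 ?(ltW xy)// dr0.
by rewrite -E subr_le0 leNgt ry.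
Unshelve. all: by end_near. Qed.

Lemma cvg_gpdf_y : gpdf x @[x --> +oo] --> (0 : R).
Proof.
pose c : R := expR (1 / 2) / Num.sqrt (2 * pi).
apply: (@squeeze_cvgr _ _ _ _ (cst 0) (fun x => c * expR (- x))).
- apply: nearW => x; rewrite /= ltW ?gpdf_gt0//= /gpdf /c mulrAC.
  rewrite ler_wpM2r ?invr_ge0 ?sqrtr_ge0// -expRD ler_expR.
  have := sqr_ge0 (x - 1); lra.
- exact: cvg_cst.
- by rewrite -[0](mulr0 c); apply: cvgMr; exact: cvgr_expR.
Qed.

Lemma Phi_ge0 w : 0 <= Phi w :> R.
Proof.
by rewrite /Phi fine_ge0// integral_ge0// => x _; rewrite lee_fin ltW ?gpdf_gt0.
Qed.

Lemma Phi_incr x y : x < y -> Phi x < Phi y :> R.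
Proof.
move=> xy; have [|c _ E] := @MVT _ _ _ _ _ xy (fun w _ => is_derive_Phi w).
  by apply: derivable_within_continuous => w _.
by rewrite -subr_gt0 E mulr_gt0 ?gpdf_gt0 ?subr_gt0.
Qed.

Lemma Phi_gt0 w : 0 < Phi w :> R.
Proof. by apply: le_lt_trans (Phi_ge0 (w - 1)) (Phi_incr _); rewrite gtrBl. Qed.

Lemma Phi_lt1 w : Phi w < 1 :> R.
Proof. by have := Phi_gt0 (- w); rewrite PhiN subr_gt0. Qed.

(** [x] is frozen as a coefficient while [y] runs beyond it: [gpdf y - x * (1 - Phi y)] has
    derivative [(x - y) * gpdf y] and vanishes at infinity. The sign of [x] is free. *)
Lemma Mills_upper x : x * (1 - Phi x) <= gpdf x.
Proof.
rewrite -subr_ge0.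
apply: (@nonincreasing_cvg0_ge0 (fun y => gpdf y - x * (1 - Phi y))
  (fun y => (x - y) * gpdf y)).
- move=> y _.
  have := is_deriveB (is_derive_gpdf y)
    (is_deriveZ x (is_deriveB (is_derive_cst (1:R) y 1) (is_derive_Phi y))).
  rewrite sub0r scalerN opprK => H.
  by rewrite (_ : (x - y) * _ = - y * gpdf y + x *: gpdf y)//= addrC mulrDl.
- by move=> y xy; rewrite mulr_le0_ge0 ?subr_le0// ltW ?gpdf_gt0.
- rewrite (_ : 0 = 0 - x * (1 - 1)); last by rewrite subrr mulr0 subr0.
  apply: cvgB; first exact: cvg_gpdf_y.
  by apply: cvgMr; apply: cvgB; [exact: cvg_cst|exact: cvg_Phi_y].
Qed.

(** The difference of [1 - Phi y] and [y * gpdf y / (1 + y^2)] has derivative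
    [- 2 * gpdf y / (1 + y^2)^2] and tends to 0. *)
Lemma Mills_lower x : 0 <= x -> x * gpdf x <= (1 + x ^+ 2) * (1 - Phi x).
Proof.
move=> x0.
have p1 y : 0 < 1 + y ^+ 2 by rewrite ltr_pwDl ?sqr_ge0.
rewrite -ler_pdivrMl// mulrA -subr_ge0.
apply: (@nonincreasing_cvg0_ge0
  (fun y => (1 - Phi y) - ((1 + y ^+ 2)^-1 * y) * gpdf y)
  (fun y => - 2 * gpdf y / (1 + y ^+ 2) ^+ 2)).
- move=> y xy.
  have := is_deriveD (is_derive_cst (1:R) y 1) (is_deriveX 2 (is_derive_id y 1)).
  move=> /(@is_deriveV _ (cst 1 + id ^+ 2) _ _ _ (lt0r_neq0 (p1 y))) D.
  have := is_deriveB (is_deriveB (is_derive_cst (1:R) y 1) (is_derive_Phi y))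
    (is_deriveM (is_deriveM D (is_derive_id y 1)) (is_derive_gpdf y)).
  move=> H; apply: (is_derive_eq H).
  change (0 - gpdf y - ((1 + y ^+ 2)^-1 * y * (- y * gpdf y) +
    gpdf y * ((1 + y ^+ 2)^-1 * 1 + y * (- (1 + y ^+ 2) ^- 2 *
      (0 + 2 * y ^+ 1 * 1)))) = -2 * gpdf y / (1 + y ^+ 2) ^+ 2).
  by have := lt0r_neq0 (p1 y); move=> ?; field.
- move=> y _; rewrite mulr_le0_ge0 ?invr_ge0 ?sqr_ge0//.
  by rewrite mulr_le0_ge0// ltW// gpdf_gt0.
- rewrite (_ : 0 = (1 - 1) - 0); last by rewrite subrr subr0.
  apply: cvgB; first by apply: cvgB; [exact: cvg_cst|exact: cvg_Phi_y].
  apply: (@squeeze_cvgr _ _ _ _ (cst 0) (@gpdf R)).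
  + near=> y; have y0 : 0 <= y by near: y; apply: nbhs_pinfty_ge; exact: num_real.
    rewrite /= mulr_ge0 ?mulr_ge0 ?invr_ge0 ?(ltW (p1 _)) ?(ltW (gpdf_gt0 _))//=.
    rewrite ler_piMl ?(ltW (gpdf_gt0 _))// mulrC ler_pdivrMr// mul1r.
    have := sqr_ge0 (y - 1); have := sqr_ge0 y; nra.
  + exact: cvg_cst.
  + exact: cvg_gpdf_y.
Unshelve. all: by end_near. Qed.

(** The usual Mills ratio [(1 - Phi) / gpdf], read at [- x]. Both branches of [fz] are multiples of
    it, at [w] on the left of [z] and at [- w] on the right. *)
Definition mills x := Phi x / gpdf x.

Lemma is_derive_mills x : is_derive x (1:R) mills (1 + x * mills x).
Proof.
have n0 := lt0r_neq0 (gpdf_gt0 x).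
have H := is_deriveM (is_derive_Phi x) (is_deriveV n0 (is_derive_gpdf x)).
rewrite /mills; apply: (is_derive_eq H).
change (Phi x * (- gpdf x ^- 2 * (- x * gpdf x)) + (gpdf x)^-1 * gpdf x = 1 + x * (Phi x / gpdf x)).
by field.
Qed.

Lemma mills_gt0 x : 0 < mills x.
Proof. by rewrite divr_gt0 ?Phi_gt0 ?gpdf_gt0. Qed.

(** The derivative is [(1 + w^2) * mills w + w]. For [w < 0] its nonnegativity is [Mills_lower] at
    [- w]. *)
Lemma id_mills_ndecr x y : x <= y -> x * mills x <= y * mills y.
Proof.
move=> xy.
have D w : is_derive w (1:R) (fun v => v * mills v)
    ((1 + w ^+ 2) * mills w + w).
  apply: (is_derive_eq (is_deriveM (is_derive_id w 1) (is_derive_mills w))).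
  change (w * (1 + w * mills w) + mills w * 1 = (1 + w ^+ 2) * mills w + w).
  ring.
have [|c _ E] := @MVT_segment _ (fun v => v * mills v) _ x y xy (fun w _ => D w).
  by apply: derivable_within_continuous => w _; have [] := D w.
rewrite -subr_ge0 E mulr_ge0 ?subr_ge0//.
have [c0|c0] := leP 0 c.
  by rewrite addr_ge0// mulr_ge0// ?(ltW (mills_gt0 _))// addr_ge0// sqr_ge0.
have := @Mills_lower (- c); rewrite oppr_ge0 (ltW c0) => /(_ isT).
rewrite gpdfN sqrrN PhiN opprB addrCA subrr addr0 mulNr => H.
by rewrite -lerBlDr sub0r /mills mulrA ler_pdivlMr ?gpdf_gt0// mulNr.
Qed.

Lemma id_mills_geN1 x : -1 <= x * mills x.
Proof.
have := Mills_upper (- x).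
rewrite PhiN opprB addrCA subrr addr0 gpdfN => H.
by rewrite /mills mulrA ler_pdivlMr ?gpdf_gt0// mulN1r lerNl -mulNr.
Qed.

Lemma fz_mills z w : fz z w =
  if w <= z then (1 - Phi z) * mills w else Phi z * mills (- w).
Proof.
rewrite /fz; case: ifP => _; first by rewrite /mills mulrA (mulrC (Phi w)).
by rewrite /mills gpdfN PhiN mulrA.
Qed.

End gauss.

(** * The solution of the Stein equation *)

Section stein.
Context {R : realType}.
Variable z : R.
Implicit Types w x y a b : R.

(** Read off from the Stein equation rather than taken as a derivative, since [fz z] has a kink at
    [z]; the strict inequality in the indicator gives [fz' z] the slope from the left. *)
Definition fz' w := w * fz z w + (1 - Phi z) - (if z < w then 1 else 0).
Definition hz w := w * fz z w + (if z < w then 1 else 0).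

Let c0 : 0 < 1 - Phi z :> R. Proof. by rewrite subr_gt0 Phi_lt1. Qed.

Lemma fz'_stein w : fz' w - w * fz z w = (1 - Phi z) - (if z < w then 1 else 0).
Proof. rewrite /fz'; ring. Qed.

Lemma id_fzE w : w * fz z w = if w <= z then (1 - Phi z) * (w * mills w)
  else - (Phi z * (- w * mills (- w))).
Proof. rewrite fz_mills; case: ifP => _; ring. Qed.

(** Each branch inherits the monotonicity of [w * mills w], and the two branches agree at [z]. *)
Lemma id_fz_ndecr a b : a <= b -> a * fz z a <= b * fz z b.
Proof.
move=> ab; rewrite !id_fzE.
have H1 x y : x <= y -> (1 - Phi z) * (x * mills x) <= (1 - Phi z) * (y * mills y).
  by move=> xy; rewrite ler_wpM2l ?(ltW c0)// id_mills_ndecr.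
have H2 x y : x <= y ->
    - (Phi z * (- x * mills (- x))) <= - (Phi z * (- y * mills (- y))).
  by move=> xy; rewrite lerN2 ler_wpM2l ?Phi_ge0// id_mills_ndecr// lerN2.
case: (leP a z) => az; case: (leP b z) => bz.
- exact: H1.
- apply: (le_trans (H1 _ _ az)); apply: le_trans (H2 _ _ (ltW bz)).
  rewrite le_eqVlt; apply/orP; left; apply/eqP.
  by rewrite /mills PhiN gpdfN; ring.
- by have := lt_le_trans az (le_trans ab bz); rewrite ltxx.
- exact: H2.
Qed.

Lemma id_fz_geN w : - (1 - Phi z) <= w * fz z w.
Proof.
have H v : v <= z -> - (1 - Phi z) <= v * fz z v.
  move=> vz; rewrite id_fzE vz -mulrN1 ler_wpM2l ?(ltW c0)//.
  exact: id_mills_geN1.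
have [/H//|/ltW zw] := leP w z.
by apply: le_trans (id_fz_ndecr zw); exact: H.
Qed.

Lemma id_fz_le w : w * fz z w <= Phi z.
Proof.
have H v : z < v -> v * fz z v <= Phi z.
  move=> zv; rewrite id_fzE (lt_geF zv) lerNl -mulrN1 ler_wpM2l ?Phi_ge0//.
  exact: id_mills_geN1.
have [wz|/H//] := leP w z.
have zz1 : z < z + 1 by rewrite ltrDl.
apply: le_trans (H _ zz1); apply: id_fz_ndecr.
by rewrite (le_trans wz)// ltW.
Qed.

Lemma norm_fz'_le1 w : `|fz' w| <= 1.
Proof.
have := id_fz_geN w; have := id_fz_le w; have := Phi_ge0 z; have := c0.
rewrite ler_norml /fz' => ? ? ? ?; case: ifP => _; lra.
Qed.

Lemma fz_MVTl a b : a <= b -> b <= z ->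
  exists2 c, a <= c <= b &
    fz z b - fz z a = (c * fz z c + (1 - Phi z)) * (b - a).
Proof.
move=> ab bz.
have D w : is_derive w (1:R) ((1 - Phi z) \*: mills)
    ((1 - Phi z) * (1 + w * mills w)).
  exact: (is_deriveZ (1 - Phi z) (is_derive_mills w)).
have [|c cab E] := @MVT_segment _ ((1 - Phi z) \*: mills) _ a b ab (fun w _ => D w).
  by apply: derivable_within_continuous => w _; have [] := D w.
move: cab; rewrite in_itv/= => /andP[ac cb].
exists c; first by rewrite ac cb.
rewrite !fz_mills bz (le_trans ab bz) (le_trans cb bz).
by apply: (etrans E); ring.
Qed.

(** The slope is that of the right-hand branch; it differs from [fz' c] only at [c = z]. *)
Lemma fz_MVTr a b : z <= a -> a <= b ->
  exists2 c, a <= c <= b &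
    fz z b - fz z a = (c * fz z c - Phi z) * (b - a).
Proof.
move=> za ab.
have fr w : z <= w -> fz z w = Phi z * mills (- w).
  rewrite le_eqVlt fz_mills => /orP[/eqP <-|/lt_geF -> //].
  by rewrite lexx /mills PhiN gpdfN; ring.
have D w : is_derive w (1:R) (fun v => Phi z * mills (- v))
    (Phi z * (- (1 + (- w) * mills (- w)))).
  have H := is_derive1_comp (is_derive_mills (- w)) (is_deriveN (is_derive_id w 1)).
  apply: (is_derive_eq (is_deriveZ (Phi z) H)).
  by rewrite mulrN1.
have [|c cab E] := @MVT_segment _ (fun v => Phi z * mills (- v)) _ a b ab (fun w _ => D w).
  by apply: derivable_within_continuous => w _; have [] := D w.
move: cab; rewrite in_itv/= => /andP[ac cb].
exists c; first by rewrite ac cb.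
rewrite !fr ?(le_trans za)// E; ring.
Qed.

(** Slopes at two points of [[a, b]] differ by a difference of values of [w * fz z w] minus a
    difference of indicators. Both functions are nondecreasing, so each difference is at most the
    increment over [[a, b]], and [hz] is their sum. The point [x] is an endpoint because [F] is
    itself one of the two values compared by [D_k]. *)
Lemma fz_rem a b x : a <= b -> x = a \/ x = b ->
  `|fz z b - fz z a - fz' x * (b - a)| <= (b - a) * (hz b - hz a).
Proof.
move=> ab xE.
have ndab := id_fz_ndecr ab.
(* A piece [[u, v]] is measured against the slope at [x] and the increment of [hz] over the whole of
   [[a, b]], so that two pieces meeting at [z] add up. *)
have S1 u v : a <= u -> u <= v -> v <= b -> v <= z ->
    `|fz z v - fz z u - fz' x * (v - u)| <= (v - u) * (hz b - hz a).
  move=> au uv vb vz; have [c /andP[uc cv] ->] := fz_MVTl uv vz.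
  have nd1 := id_fz_ndecr (le_trans au uc).
  have nd2 := id_fz_ndecr (le_trans cv vb).
  rewrite -mulrBl normrM (ger0_norm (_ : 0 <= v - u)) ?subr_ge0// mulrC.
  apply: ler_wpM2l; first by rewrite subr_ge0.
  have za : (z < a) = false by apply/negbTE; rewrite -leNgt (le_trans au)// (le_trans uv).
  rewrite ler_norml /fz' /hz za; case: xE => ->; rewrite ?za;
    first by case: ifP => _; lra.
  by case: ifP => _; lra.
have S2 u v : z < b -> z <= u -> a <= u -> u <= v -> v <= b ->
    `|fz z v - fz z u - fz' x * (v - u)| <= (v - u) * (hz b - hz a).
  move=> zb zu au uv vb; have [c /andP[uc cv] ->] := fz_MVTr zu uv.
  have nd1 := id_fz_ndecr (le_trans au uc).
  have nd2 := id_fz_ndecr (le_trans cv vb).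
  rewrite -mulrBl normrM (ger0_norm (_ : 0 <= v - u)) ?subr_ge0// mulrC.
  apply: ler_wpM2l; first by rewrite subr_ge0.
  rewrite ler_norml /fz' /hz zb; case: xE => ->; rewrite ?zb; last first.
    by case: ifP => _; lra.
  by case: ifP => _; lra.
have [bz|zb] := leP b z; first exact: S1.
have [az|za] := leP a z; last by apply: S2 => //; exact: ltW.
have H1 := S1 a z (lexx _) az (ltW zb) (lexx _).
have H2 := S2 z b zb (lexx _) az (ltW zb) (lexx _).
have -> : fz z b - fz z a - fz' x * (b - a) =
  (fz z z - fz z a - fz' x * (z - a)) + (fz z b - fz z z - fz' x * (b - z)) by ring.
apply: (le_trans (ler_normD _ _)); apply: (le_trans (lerD H1 H2)).
by rewrite -mulrDl (_ : z - a + (b - z) = b - a)//; ring.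
Qed.

Lemma fz_lip a b : `|fz z b - fz z a| <= `|b - a|.
Proof.
wlog ab : a b / a <= b.
  move=> H; have [/H//|/ltW/H] := leP a b.
  by rewrite distrC [X in _ <= X -> _]distrC.
have S1 u v : u <= v -> v <= z -> `|fz z v - fz z u| <= v - u.
  move=> uv vz; have [c _ ->] := fz_MVTl uv vz.
  rewrite normrM (ger0_norm (_ : 0 <= v - u)) ?subr_ge0// ler_piMl ?subr_ge0//.
  have := id_fz_geN c; have := id_fz_le c; have := Phi_ge0 z; have := c0.
  by rewrite ler_norml => *; lra.
have S2 u v : z <= u -> u <= v -> `|fz z v - fz z u| <= v - u.
  move=> zu uv; have [c _ ->] := fz_MVTr zu uv.
  rewrite normrM (ger0_norm (_ : 0 <= v - u)) ?subr_ge0// ler_piMl ?subr_ge0//.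
  have := id_fz_geN c; have := id_fz_le c; have := Phi_ge0 z; have := c0.
  by rewrite ler_norml => *; lra.
rewrite (ger0_norm (_ : 0 <= b - a)) ?subr_ge0//.
have [bz|zb] := leP b z; first exact: S1.
have [az|za] := leP a z; last by apply: S2 => //; exact: ltW.
have -> : fz z b - fz z a = (fz z z - fz z a) + (fz z b - fz z z) by ring.
apply: (le_trans (ler_normD _ _)).
by apply: (le_trans (lerD (S1 _ _ az (lexx _)) (S2 _ _ (lexx _) (ltW zb)))); lra.
Qed.

(** Left of 0 the product [w * fz z w] stays in [[- (1 - Phi z), 0]], so the factor [1 - Phi z]
    comes without any exponential weight. *)
Lemma fz'_bound_neg w : 0 <= z -> w <= 0 -> `|fz' w| <= 1 - Phi z /\ `|hz w| <= 1 - Phi z.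
Proof.
move=> z0 w0; have H1 := id_fz_geN w.
have H2 : w * fz z w <= 0 * fz z 0 by exact: id_fz_ndecr.
rewrite mul0r in H2.
have wz : (z < w) = false by rewrite ltNge (le_trans w0 z0).
by rewrite /fz' /hz wz subr0 addr0; split; rewrite ler_norml; lra.
Qed.

Lemma fz'_bound_mid w : 0 < w -> w <= z ->
  let K := (1 - Phi z) * (1 + Num.sqrt (2 * pi) * (w * expR (w ^+ 2 / 2))) in
  `|fz' w| <= K /\ `|hz w| <= K.
Proof.
move=> w0 wz K.
have H : 0 <= w * fz z w <= (1 - Phi z) * (Num.sqrt (2 * pi) * (w * expR (w ^+ 2 / 2))).
  rewrite id_fzE wz; apply/andP; split.
    by rewrite mulr_ge0 ?(ltW c0)// mulr_ge0 ?ltW// mills_gt0.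
  apply: ler_wpM2l; first exact: ltW.
  rewrite [leRHS]mulrCA; apply: ler_wpM2l; first exact: ltW.
  rewrite /mills /gpdf invf_div mulNr expRN invrK mulrC -[leRHS]mulr1.
  apply: ler_wpM2l; last exact: ltW (Phi_lt1 _).
  by rewrite mulr_ge0 ?sqrtr_ge0 ?expR_ge0.
have zw : (z < w) = false by rewrite ltNge wz.
rewrite /fz' /hz zw subr0 addr0 /K mulrDr mulr1.
by move/andP : H => [H1 H2]; have := c0; move=> H3; split; rewrite ger0_norm; lra.
Qed.

Lemma hz_le2 w : `|hz w| <= 2.
Proof.
have := id_fz_geN w; have := id_fz_le w; have := Phi_ge0 z; have := c0.
by rewrite ler_norml /hz => ? ? ? ?; case: ifP => _; lra.
Qed.

(** Only the mass of [[z, z + 1 / (1 + z)]] is kept: there [c^2 / 2] exceeds [z^2 / 2] by at most 1,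
    whence the factor [expR 1]. In contrast with [Mills_lower], the bound does not degenerate at
    [z = 0]. *)
Lemma Phi_tail_lower : 0 <= z ->
  expR (- (z ^+ 2 / 2)) <= expR 1 * Num.sqrt (2 * pi) * (1 + z) * (1 - Phi z).
Proof.
move=> z0; have z1 : 0 < 1 + z by rewrite ltr_pwDl.
set s := Num.sqrt _; have s0 : 0 < s by rewrite sqrtr_gt0 mulr_gt0// pi_gt0.
pose a := (1 + z)^-1; have a0 : 0 < a by rewrite invr_gt0.
have a1 : (1 + z) * a = 1 by rewrite divff// gt_eqF.
have zza : z <= z + a by rewrite lerDl ltW.
have [|c] := @MVT_segment _ (@Phi R) _ z (z + a) zza (fun w _ => is_derive_Phi w).
  by apply: derivable_within_continuous => w _.
rewrite in_itv/= => /andP[zc ca] E.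
have P1 := Phi_lt1 (z + a).
have : gpdf c * a <= 1 - Phi z by move: E; rewrite (addrC z a) addrK (addrC a z); lra.
move=> H.
have : expR (- (z ^+ 2 / 2)) <= expR 1 * s * gpdf c.
  rewrite (_ : _ * gpdf c = expR 1 * expR (- c ^+ 2 / 2)); last first.
    by rewrite /gpdf -/s; field; rewrite gt_eqF.
  rewrite -expRD ler_expR.
  have c2 : c ^+ 2 <= (z + a) ^+ 2 by rewrite ler_sqr ?nnegrE; lra.
  have a2 : a * a <= 2 * a * 1; last by nra.
  have : a * 1 <= a * (1 + z) by rewrite ler_wpM2l ?(ltW a0)// lerDl.
  nra.
move=> H2; apply: (le_trans H2); rewrite -[leRHS]mulrA.
rewrite ler_wpM2l ?mulr_ge0 ?expR_ge0 ?(ltW s0)//.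
by rewrite -ler_pdivrMl// mulrC.
Qed.

End stein.

(** * Resampling one coordinate *)

Section rademacher.
Context {R : realType} {d : measure_display} {T : measurableType d}.
Context (P : probability T R) (X : nat -> T -> R) (p : nat -> R).
Hypothesis HX : rademacher_family P X p.

Local Notation V := (g_sigma_algebraType (@cyl R)).

Lemma gmeasurableP (g : (nat -> R) -> R) :
  gmeasurable g <-> measurable_fun setT (g : V -> R).
Proof.
split=> [mg _ B mB|mg B mB]; first by rewrite setTI; exact: mg.
by rewrite -[X in <<s _ >> X]setTI; exact: mg.
Qed.

Lemma measurable_fun_seq d' (S : measurableType d') (Z : S -> V) :
  (forall k, measurable_fun setT (fun w => Z w k)) -> measurable_fun setT Z.
Proof.
move=> mZ.
have := @measurability _ _ S V setT Z (@cyl R) erefl. apply.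
by move=> _ [_ [k [B [mB ->]]] <-]; exact: mZ.
Qed.

Lemma measurable_X k : measurable_fun setT (X k).
Proof. by case: HX. Qed.

Lemma measurable_X_set k (B : set R) : measurable B -> measurable (X k @^-1` B).
Proof. by move=> mB; rewrite -[X in measurable X]setTI; exact: measurable_X. Qed.

Lemma p_gt0 k : 0 < p k. Proof. by case: HX => /(_ k)/andP[]. Qed.
Lemma q_gt0 k : 0 < q_ p k.
Proof. by case: HX => /(_ k)/andP[_ ?] _ _ _ _; rewrite subr_gt0. Qed.

Lemma measurable_Xvec : measurable_fun setT (Xvec X : T -> V).
Proof. exact/measurable_fun_seq/measurable_X. Qed.

Lemma measurable_upd k a :
  measurable_fun setT ((fun w => upd (Xvec X w) k a) : T -> V).
Proof.
apply: measurable_fun_seq => j; rewrite /upd.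
by case: (j == k) => //; exact: measurable_X.
Qed.

(** The two probabilities add up to 1, so the sample points where [X k] takes another value form a
    null set. *)
Lemma probability_sign_split k (E : set T) : measurable E ->
  (P E = P (E `&` X k @^-1` [set 1%R]) + P (E `&` X k @^-1` [set (-1)%R]))%E.
Proof.
move=> mE; case: HX => _ _ /(_ k) P1 /(_ k) PN1 _.
have m1 := measurable_X_set k (measurable_set1 (1:R)).
have mN1 := measurable_X_set k (measurable_set1 (-1:R)).
set A := X k @^-1` [set 1%R] in P1 m1 *.
set B := X k @^-1` [set (-1)%R] in PN1 mN1 *.
have AB0 : A `&` B = set0.
  rewrite /A /B -subset0 => x [/= -> ]; lra.
have mAB : measurable (A `|` B) by exact: measurableU.
have PAB : P (~` (A `|` B)) = 0%E.
  rewrite probability_setC// measureU// [X in (_ - X)%E](_ : _ = 1%E) ?subee//.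
  by rewrite -[X in (X + _)%E]/(P A) P1 -[X in (_ + X)%E]/(P B) PN1 -EFinD addrC subrK.
rewrite -measureU//; last 3 first.
- exact: measurableI.
- exact: measurableI.
- by rewrite setIACA AB0 setI0.
rewrite -setIUr -[in LHS](setUIDK E (A `|` B)) measureU//.
- rewrite [X in (_ + X)%E](_ : _ = 0%E) ?adde0//.
  apply/eqP; rewrite eq_le measure_ge0 andbT -PAB.
  apply: le_measure; rewrite ?inE; last by move=> x [].
    exact: (measurableD mE mAB).
  exact: measurableC.
- exact: (measurableI _ _ mE mAB).
- exact: (measurableD mE mAB).
- by rewrite -subset0 => x [[_ ?] [_ ?]].
Qed.

(* Measurable constraints on the coordinates below [m], exact values from [m] on,
   none on [k]: independence from [X k] is proved by induction on [m], starting
   from the product rule for exact values. *)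
Definition mixed_cylinder (n k m : nat) (B : nat -> set R) (e : nat -> R) : set T :=
  [set x | forall i, (i < n)%N -> i != k ->
    ((i < m)%N -> B i (X i x)) /\ ((m <= i)%N -> X i x = e i)].

Lemma measurable_mixed_cylinder n k m B e : (forall i, measurable (B i)) ->
  measurable (mixed_cylinder n k m B e).
Proof.
move=> mB.
rewrite (_ : mixed_cylinder _ _ _ _ _ = \bigcap_(i in [set i | (i < n)%N && (i != k)])
   X i @^-1` (if (i < m)%N then B i else [set e i])).
  apply: bigcap_measurableType => i _; apply: measurable_X_set.
  by case: ifP => // _; exact: measurable_set1.
apply/seteqP; split => [x Hx i /= /andP[ni ik]|x Hx i ni ik].
  by have [im|im] := ltnP i m; have [H1 H2] := Hx i ni ik; [exact: H1|exact: H2].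
have /= := Hx i; rewrite ni ik => /(_ isT).
by have [im|im] := ltnP i m; split => //; rewrite ltnNge im.
Qed.

Lemma mixed_cylinder_indep n k m B e a : (m <= n)%N -> (forall i, measurable (B i)) ->
  P (mixed_cylinder n k m B e `&` X k @^-1` [set a]) =
  (P (X k @^-1` [set a]) * P (mixed_cylinder n k m B e))%E.
Proof.
move=> + mB; elim: m e => [|m IH] e mn.
  case: HX => _ _ _ _ indep.
  pose s := [seq i <- iota 0 n | i != k].
  have us : uniq s by rewrite filter_uniq ?iota_uniq.
  have ks : k \notin s by rewrite mem_filter eqxx.
  have condE : mixed_cylinder n k 0 B e = \bigcap_(i in [set i | i \in s]) X i @^-1` [set e i].
    apply/seteqP; split => [x Hx i /=|x Hx i ni ik].
      rewrite mem_filter mem_iota => /and3P[ik _ ni].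
      by have [_ ->] := Hx i ni ik.
    split => // _; apply: (Hx i); rewrite /= mem_filter ik mem_iota ni//.
  pose e' := fun i => if i == k then a else e i.
  have := indep (k :: s) e'; rewrite /= ks us big_cons => /(_ isT).
  have := indep s e us.
  rewrite -condE => ->.
  rewrite /e' eqxx (eq_big_seq (fun i => fine (P (X i @^-1` [set e i])))); last first.
    move=> i si; case: eqP => // ik; by rewrite -ik si in ks.
  rewrite EFinM fineK ?fin_num_measure//; last exact/measurable_X_set.
  move=> <-; congr (P _); rewrite condE; apply/seteqP; split => [x [Hx xa] i|x Hx].
    rewrite /= in_cons; case: eqP => [->//|_ /=]; exact: Hx.
  split; last by have /= := Hx k; rewrite in_cons eqxx => /(_ isT).
  move=> i /= si; have /= := Hx i; rewrite in_cons si orbT => /(_ isT).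
  by case: eqP => // ik; rewrite -ik si in ks.
have [mk|mk] := eqVneq m k.
  have -> : mixed_cylinder n k m.+1 B e = mixed_cylinder n k m B e.
    apply/seteqP; split => x Hx i ni ik; have [H1 H2] := Hx i ni ik; split.
    - by move=> im; apply: H1; rewrite ltnS ltnW.
    - by rewrite leq_eqVlt => /orP[/eqP mi|//]; rewrite -mi mk eqxx in ik.
    - by rewrite ltnS leq_eqVlt => /orP[/eqP mi|//]; rewrite mi mk eqxx in ik.
    - by move=> im; apply: H2; rewrite ltnW.
  by apply: IH; exact: ltnW.
pose eb b := fun i => if i == m then b else e i.
have E2 b : mixed_cylinder n k m B (eb b) `&` X m @^-1` [set b] = mixed_cylinder n k m B (eb b).
  apply/setIidPl => x Hx; have [_ /(_ (leqnn m))] := Hx m mn mk.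
  by rewrite /eb eqxx.
(* On [X m = b] the constraint [B m] either becomes the exact value [b] or is impossible; this
   reduces [m.+1] to [m]. *)
have E b : mixed_cylinder n k m.+1 B e `&` X m @^-1` [set b] =
    if b \in B m then mixed_cylinder n k m B (eb b) else set0.
  case: ifPn => [/set_mem|/negP] bB.
    rewrite -E2; apply/seteqP; split => x [Hx xb]; split => // i ni ik;
        have [H1 H2] := Hx i ni ik; split.
    - by move=> im; apply: H1; rewrite ltnS ltnW.
    - rewrite /eb; case: eqP => [-> _|/eqP im mi]; first exact: xb.
      by apply: H2; rewrite ltn_neqAle eq_sym im.
    - rewrite ltnS leq_eqVlt => /orP[/eqP ->|//]; by rewrite (xb : X m x = b).
    - move=> im; rewrite (H2 (ltnW im)) /eb; case: eqP => // imE.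
      by rewrite imE ltnn in im.
  rewrite -subset0 => x [Hx xb]; have [/(_ (ltnSn _)) + _] := Hx m mn mk.
  by rewrite (xb : X m x = b) => /mem_set.
rewrite (probability_sign_split m (measurable_mixed_cylinder _ _ _ _ _))//.
rewrite (@probability_sign_split m (_ `&` X k @^-1` _)); last first.
  by apply: measurableI; [exact: measurable_mixed_cylinder|exact: measurable_X_set].
rewrite -![_ `&` X k @^-1` _ `&` _]setIAC !E.
rewrite ge0_muleDr//; congr (_ + _)%E;
  by case: ifP => _; [exact/IH/ltnW|rewrite set0I measure0 mule0].
Qed.

(** [mu1] is the law of the sequence on [V], and [mu2 a k] its law after coordinate [k] has been set
    to [a]. The mixture [mix k] of [mu2 1 k] and [mu2 (-1) k] redraws that coordinate. *)
Let mu1 : {measure set V -> \bar R} :=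
  measure_function_pushforward__canonical__measure_function_Measure P measurable_Xvec.

Let mu2 a k : {measure set V -> \bar R} :=
  measure_function_pushforward__canonical__measure_function_Measure P
    (measurable_upd k a).

Let pn k : {nonneg R} := NngNum (ltW (p_gt0 k)).
Let qn k : {nonneg R} := NngNum (ltW (q_gt0 k)).

Let mix k : {measure set V -> \bar R} :=
  measure_add (mscale (pn k) (mu2 1 k)) (mscale (qn k) (mu2 (-1) k)).

(** Unlike the one-coordinate sets of [cyl], finite-dimensional rectangles are stable under
    intersection, as the uniqueness theorem for measures requires. *)
Let rect : set (set V) := [set D | exists n B, (forall i, measurable (B i)) /\
  D = [set v | forall i, (i < n)%N -> B i (v i)]].

Lemma sigma_rect : <<s rect >> = <<s @cyl R >>.
Proof.
apply/seteqP; split; apply: smallest_sub; try exact: smallest_sigma_algebra.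
  move=> _ [n [B [mB ->]]].
  rewrite (_ : [set v | _] = \bigcap_(i in [set i | (i < n)%N])
      ((fun v : V => v i) @^-1` B i)).
    have : measurable (\bigcap_(i in [set i | (i < n)%N])
      ((fun v : V => v i) @^-1` B i)).
      apply: bigcap_measurableType => i _.
      by apply: sub_sigma_algebra; exists i, (B i).
    by [].
  by [].
move=> _ [k [B [mB ->]]]; apply: sub_sigma_algebra.
exists k.+1, (fun i => if i == k then B else setT); split.
  by move=> i; case: ifP.
apply/seteqP; split => [v Bv i _|v /(_ k (ltnSn _))]; last by rewrite eqxx.
by case: eqP => // ->.
Qed.

Lemma setI_closed_rect : setI_closed rect.
Proof.
move=> _ _ [n [B [mB ->]]] [m [C [mC ->]]].
exists (maxn n m), (fun i => (if (i < n)%N then B i else setT) `&`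
  (if (i < m)%N then C i else setT)); split.
  by move=> i; apply: measurableI; case: ifP.
apply/seteqP; split => [v [Bv Cv] i _|v BCv].
  split; first by case: ifP => // /Bv.
  by case: ifP => // /Cv.
split => i ni; have := BCv i; rewrite leq_max ni ?orbT => /(_ isT) [].
  by [].
by [].
Qed.

Lemma mixE k D : mix k D = ((p k)%:E * P ((fun x => upd (Xvec X x) k 1%R) @^-1` D)
  + (q_ p k)%:E * P ((fun x => upd (Xvec X x) k (-1)%R) @^-1` D))%E.
Proof.
exact: (measure_addE (mscale (pn k) (mu2 1 k)) (mscale (qn k) (mu2 (-1) k)) D).
Qed.

(** Finite measures that agree on rectangles are equal. A rectangle splits by the sign of [X k], and
    its constraints on the other coordinates are independent of that sign. *)
Lemma law_resample k D : <<s @cyl R >> D -> mu1 D = mix k D.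
Proof.
rewrite -sigma_rect.
apply: (@g_sigma_algebra_measure_unique _ _ V rect _ (fun=> setT)).
- by move=> E rE; rewrite /measurable /= -sigma_rect; exact: sub_sigma_algebra.
- by move=> _; exists 0%N, (fun=> setT); split => //; apply/seteqP; split.
- by rewrite bigcup_const//; exists 0%N.
- exact: setI_closed_rect.
- move=> _ [n [B [mB ->]]]; rewrite mixE.
  set D0 := [set v | _]; rewrite [LHS](_ : _ = P (Xvec X @^-1` D0))//.
  pose E := mixed_cylinder n k n B (fun=> 0).
  have mE : measurable E by exact: measurable_mixed_cylinder.
  (* The value [b] meets the constraint on coordinate [k], which exists only if [k < n]. *)
  pose good b := (k < n)%N ==> (b \in B k).
  have D0upd b : (fun x => upd (Xvec X x) k b) @^-1` D0 = if good b then E else set0.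
    rewrite /good; have [kn|kn] /= := ltnP k n; last first.
      apply/seteqP; split => x Dx i ni => [ik|].
        have := Dx i ni; rewrite /upd (negbTE ik) => BX.
        by split => //; rewrite leqNgt ni.
      rewrite /upd; case: eqP => [ik|/eqP ik].
        by rewrite ik ltnNge kn in ni.
      by have [/(_ ni)] := Dx i ni ik.
    case: ifPn => [/set_mem bB|/negP bB].
      apply/seteqP; split => x Dx i ni => [ik|].
        have := Dx i ni; rewrite /upd (negbTE ik) => BX.
        by split => //; rewrite leqNgt ni.
      rewrite /upd; case: eqP => [->//|/eqP ik].
      by have [/(_ ni)] := Dx i ni ik.
    by rewrite -subset0 => x /(_ k kn); rewrite /upd eqxx => /mem_set.
  have D0X b : Xvec X @^-1` D0 `&` X k @^-1` [set b] =
      if good b then E `&` X k @^-1` [set b] else set0.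
    rewrite (_ : _ `&` _ = (fun x => upd (Xvec X x) k b) @^-1` D0 `&` X k @^-1` [set b]).
      by rewrite D0upd; case: ifP => // _; rewrite set0I.
    apply/seteqP; split => x [Dx xb]; split => // i ni; have := Dx i ni; rewrite /upd /=.
      by case: eqP => // ->; rewrite -(xb : X k x = b).
    by case: eqP => // ->; rewrite -(xb : X k x = b).
  have mD0 : measurable (Xvec X @^-1` D0).
    rewrite -[X in measurable X]setTI; apply: measurable_Xvec => //.
    rewrite /measurable /= -sigma_rect; apply: sub_sigma_algebra.
    by exists n, B.
  rewrite (probability_sign_split k mD0) !D0X !D0upd.
  case: HX => _ _ /(_ k) P1 /(_ k) PN1 _.
  rewrite -P1 -PN1.
  by congr (_ + _)%E; case: ifP => _; rewrite ?measure0 ?mule0// mixed_cylinder_indep.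
- move=> _; change (P (Xvec X @^-1` setT) < +oo)%E.
  by rewrite preimage_setT probability_setT ltry.
Qed.

Lemma ge0_integral_resample k (g : (nat -> R) -> R) :
  gmeasurable g -> (forall v, 0 <= g v) ->
  (\int[P]_x (g (Xvec X x))%:E =
   (p k)%:E * \int[P]_x (g (upd (Xvec X x) k 1))%:E +
   (q_ p k)%:E * \int[P]_x (g (upd (Xvec X x) k (-1)))%:E)%E.
Proof.
move=> /gmeasurableP mg0 g0.
have mg : measurable_fun [set: V] (fun v : V => (g v)%:E) by apply/measurable_EFinP.
have g0' : {in [set: V], forall y, (0 <= (EFin \o g) y)%E}.
  by move=> v _; rewrite lee_fin.
have <- : (\int[mu1]_(v in setT) (EFin \o g) v = \int[P]_x (g (Xvec X x))%:E)%E.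
  exact: (ge0_integral_pushforward measurable_Xvec P measurableT mg g0').
rewrite (eq_measure_integral (mix k)); last first.
  by move=> D mD _; exact: law_resample.
rewrite (ge0_integral_measure_add (mscale (pn k) (mu2 1 k))
  (mscale (qn k) (mu2 (-1) k)) measurableT _ mg); last by move=> v _; rewrite lee_fin.
rewrite (ge0_integral_mscale (mu2 1 k) measurableT (pn k) mg); last first.
  by move=> v _; rewrite lee_fin.
rewrite (ge0_integral_mscale (mu2 (-1) k) measurableT (qn k) mg); last first.
  by move=> v _; rewrite lee_fin.
congr (_ * _ + _ * _)%E.
  exact: (ge0_integral_pushforward (measurable_upd k 1) P measurableT mg g0').
exact: (ge0_integral_pushforward (measurable_upd k (-1)) P measurableT mg g0').
Qed.

Lemma gmeasurable_Xvec g : gmeasurable g ->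
  measurable_fun setT (rv X g).
Proof. move=> /gmeasurableP mg; exact: (measurableT_comp mg measurable_Xvec). Qed.

Lemma gmeasurable_upd g k a : gmeasurable g ->
  measurable_fun setT (fun x => g (upd (Xvec X x) k a)).
Proof. move=> /gmeasurableP mg; exact: (measurableT_comp mg (measurable_upd k a)). Qed.

(** The nonnegative case applied to [|g|] bounds both integrals, as [p k] and [q_ p k] are positive;
    the identity then follows for the positive and the negative part of [g] separately. *)
Lemma integrable_resample k (g : (nat -> R) -> R) :
  gmeasurable g -> P.-integrable setT (EFin \o rv X g) ->
  [/\ P.-integrable setT (fun x => (g (upd (Xvec X x) k 1))%:E),
   P.-integrable setT (fun x => (g (upd (Xvec X x) k (-1)))%:E) &
  \int[P]_x (rv X g x) = p k * \int[P]_x (g (upd (Xvec X x) k 1))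
    + q_ p k * \int[P]_x (g (upd (Xvec X x) k (-1)))].
Proof.
move=> mg igX.
have mupd b := gmeasurable_upd k b mg.
have mX := gmeasurable_Xvec mg.
have gm_comp (h : R -> R) : measurable_fun setT h -> gmeasurable (h \o g).
  by move=> mh; apply/gmeasurableP; apply: measurableT_comp => //; exact/gmeasurableP.
have lty_of (c : R) (I J : \bar R) : 0 < c -> (0 <= I)%E -> (0 <= J)%E ->
    (c%:E * I + J < +oo)%E -> (I < +oo)%E.
  move=> c_gt0; case: I => [r| |] //=; first by rewrite ltry.
  by move=> _ J0; rewrite gt0_muley ?lte_fin// addye// gt_eqF// (lt_le_trans _ J0).
have int_ge0 b : (0 <= \int[P]_x (`|g (upd (Xvec X x) k b)|)%:E)%E.
  by apply: integral_ge0 => x _; rewrite lee_fin.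
have := ge0_integral_resample k (gm_comp _ (@normr_measurable R setT)) (fun v => normr_ge0 _).
move/integrableP : (igX) => [_] /[swap] E; rewrite {}E => iE.
have iupd b : b = 1 \/ b = -1 ->
    P.-integrable setT (fun x => (g (upd (Xvec X x) k b))%:E).
  move=> bE; apply/integrableP; split; first exact/measurable_EFinP.
  have cJ c b' : 0 < c -> (0 <= c%:E * \int[P]_x (`|g (upd (Xvec X x) k b')|)%:E)%E.
    by move=> c_gt0; rewrite mule_ge0 ?int_ge0// lee_fin ltW.
  case: bE => ->.
    exact: (lty_of _ _ _ (p_gt0 k) (int_ge0 1) (cJ _ (-1) (q_gt0 k)) iE).
  rewrite addeC in iE.
  exact: (lty_of _ _ _ (q_gt0 k) (int_ge0 (-1)) (cJ _ 1 (p_gt0 k)) iE).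
have i1 := iupd 1 (or_introl erefl); have iN1 := iupd (-1) (or_intror erefl).
have part (h : R -> R) : measurable_fun setT h -> (forall y, 0 <= h y <= `|y|) ->
  [/\ P.-integrable setT (fun x => (h (g (upd (Xvec X x) k 1)))%:E),
   P.-integrable setT (fun x => (h (g (upd (Xvec X x) k (-1))))%:E) ,
   P.-integrable setT (fun x => (h (rv X g x))%:E) &
  \int[P]_x (h (rv X g x)) = p k * \int[P]_x (h (g (upd (Xvec X x) k 1)))
    + q_ p k * \int[P]_x (h (g (upd (Xvec X x) k (-1))))].
  move=> mh h0.
  have dom (u : T -> R) : measurable_fun setT u -> P.-integrable setT (EFin \o u) ->
      P.-integrable setT (EFin \o (h \o u)).
    move=> mu; apply: le_integrable => //.
      by apply/measurable_EFinP; exact: measurableT_comp.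
    move=> x _; rewrite lee_fin /=; have /andP[? ?] := h0 (u x).
    by rewrite ger0_norm.
  have j1 := dom _ (mupd 1) i1; have jN1 := dom _ (mupd (-1)) iN1.
  have jX := dom _ mX igX; split => //.
  have := ge0_integral_resample k (gm_comp _ mh) (fun v => proj1 (andP (h0 (g v)))).
  move=> /(congr1 fine) E; apply: (etrans E).
  by rewrite fineD ?fineM ?fin_numM ?integrable_fin_num.
have [||a1 a2 a3 a4] := part (fun y => Num.max y 0).
- exact: measurable_funrpos.
- by move=> y; rewrite le_max lexx orbT ge_max normr_ge0 ler_norm.
have [||b1 b2 b3 b4] := part (fun y => Num.max (- y) 0).
- exact: measurable_funrneg.
- by move=> y; rewrite le_max lexx orbT ge_max normr_ge0 -normrN ler_norm.
split => //.
have split_pm (y : R) : y = Num.max y 0 - Num.max (- y) 0.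
  by rewrite /Num.max; case: ifP => ?; case: ifP => ?; lra.
have D (u : T -> R) : \int[P]_x (u x) = \int[P]_x (Num.max (u x) 0 - Num.max (- u x) 0).
  by apply: eq_Rintegral => x _; exact: split_pm.
rewrite (D (rv X g)) (D (fun x => g (upd (Xvec X x) k 1))).
rewrite (D (fun x => g (upd (Xvec X x) k (-1)))) !RintegralB// a4 b4; ring.
Qed.

(** Pointwise this is the variance of a two-point law: [p a^2 + q b^2 - p q (a - b)^2 = (p a + q
    b)^2]. *)
Lemma Dk_resample_sqr g k : gmeasurable g ->
  (\int[P]_x ((Dk X p g k x) ^+ 2)%:E <= \int[P]_x ((rv X g x) ^+ 2)%:E)%E.
Proof.
move=> mg.
have mg2 : gmeasurable (fun v => g v ^+ 2).
  by apply/gmeasurableP; apply: measurable_funX; exact/gmeasurableP.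
rewrite (ge0_integral_resample k mg2); last by move=> v; exact: sqr_ge0.
have m2 b : measurable_fun setT (fun x => ((g (upd (Xvec X x) k b)) ^+ 2)%:E).
  apply/measurable_EFinP; exact: gmeasurable_upd mg2.
rewrite -!ge0_integralZl_EFin//; try by [move=> x _; rewrite lee_fin sqr_ge0|
  exact: ltW (p_gt0 k)|exact: ltW (q_gt0 k)].
rewrite -ge0_integralD//; try by [move=> x _; rewrite -EFinM lee_fin mulr_ge0 ?sqr_ge0 ?(ltW (p_gt0 k)) ?(ltW (q_gt0 k))|exact: measurable_funeM].
apply: ge0_le_integral => //.
- by move=> x _; rewrite lee_fin sqr_ge0.
- apply/measurable_EFinP; apply: measurable_funX; apply: measurable_funM => //.
  by apply: measurable_funB; exact: gmeasurable_upd.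
- by apply: emeasurable_funD; exact: measurable_funeM.
move=> x _; rewrite -!EFinM -EFinD lee_fin /Dk exprMn sqr_sqrtr; last first.
  by rewrite mulr_ge0// ltW ?p_gt0 ?q_gt0.
set a := g _; set b := g _; rewrite -subr_ge0 /q_.
rewrite (_ : _ - _ = (p k * a + (1 - p k) * b) ^+ 2) ?sqr_ge0//; ring.
Qed.

End rademacher.

(** * Square-integrable sequences *)

Section square_integrable.
Context {R : realType} {d : measure_display} {T : measurableType d}.
Context {P : probability T R}.
Implicit Types (g h u : T -> R) (a b : nat -> T -> R).

(** The Cauchy criterion with countably many tolerances. The set matters because [inner] is a
    [limn], which has a default value where the series diverges. *)
Lemma measurable_cvgn_set (u : nat -> T -> R) :
  (forall n, measurable_fun setT (u n)) -> measurable [set x | cvgn (u ^~ x)].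
Proof.
move=> mu.
rewrite (_ : [set x | _] = \bigcap_e \bigcup_N \bigcap_(n in [set n | (N <= n)%N])
    [set x | `|u N x - u n x| < (e.+1%:R)^-1]).
  apply: bigcapT_measurable => e; apply: bigcupT_measurable => N.
  apply: bigcap_measurableType => n _.
  rewrite -[X in measurable X]setTI.
  apply: measurable_fun_ltr => //.
  by apply: measurableT_comp => //; exact: measurable_funB.
apply/seteqP; split => x /=.
  move=> /cvgrPdist_lt; set l := limn _ => cu e _.
  have : 0 < (e.+1%:R)^-1 :> R by rewrite invr_gt0.
  move: (_^-1) => t t0; have e0 : 0 < t / 2 by rewrite divr_gt0.
  have [N _ HN] := cu _ e0.
  exists N => // n /= Nn.
  have := HN N (leqnn _); have := HN n Nn; rewrite /= => H1 H2.
  rewrite (_ : _ - _ = (l - u n x) - (l - u N x)); last by ring.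
  by apply: (le_lt_trans (ler_normB _ _)); lra.
move=> Cx; apply: cauchy_cvg; apply: cauchy_exP => e e0.
have [N _ HN] := Cx (Num.truncn e^-1) I.
exists (u N x); exists N => // n /= Nn.
apply: (lt_le_trans (HN n Nn)).
by rewrite invf_ple ?posrE// ltW// truncnS_gt.
Qed.

Lemma measurable_fun_limnr (u : nat -> T -> R) :
  (forall n, measurable_fun setT (u n)) ->
  measurable_fun setT (fun x => limn (u ^~ x)).
Proof.
move=> mu; have mC := measurable_cvgn_set mu.
apply: (@measurable_fun_cvg _ _ _ _
  (fun n x => if x \in [set x | cvgn (u ^~ x)] then u n x else (point : R))).
  move=> n; apply: measurable_fun_ifT => //.
  by apply: (measurable_fun_bool true); rewrite setTI preimage_mem_true.
move=> x _ /=; have [cx|cx] := pselect (cvgn (u ^~ x)).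
  by rewrite mem_set.
by rewrite memNset// dvgP//; exact: cvg_cst.
Qed.

Lemma measurable_inner a b : (forall k, measurable_fun setT (a k)) ->
  (forall k, measurable_fun setT (b k)) -> measurable_fun setT (inner a b).
Proof.
move=> ma mb; apply: measurable_fun_limnr => n.
by apply: measurable_sum => k; exact: measurable_funM.
Qed.

Definition l2_finite a := (forall k, measurable_fun setT (a k)) /\
  (\int[P]_x (\sum_(0 <= k <oo) ((a k x) ^+ 2)%:E)%E < +oo)%E.

Let sq_ge0 (r : R) : (0 <= (r ^+ 2)%:E)%E.
Proof. by rewrite lee_fin sqr_ge0. Qed.

Lemma measurable_nneseries_sqr a : (forall k, measurable_fun setT (a k)) ->
  measurable_fun setT (fun x => \sum_(0 <= k <oo) ((a k x) ^+ 2)%:E)%E.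
Proof.
move=> ma; apply: ge0_emeasurable_sum => //= k _.
by apply/measurable_EFinP; exact: measurable_funX.
Qed.

Lemma l2_finite_integrable a : l2_finite a ->
  P.-integrable setT (fun x => (\sum_(0 <= k <oo) ((a k x) ^+ 2)%:E)%E).
Proof.
move=> [ma ia]; apply/integrableP; split; first exact: measurable_nneseries_sqr.
under eq_integral do rewrite gee0_abs ?nneseries_ge0//.
exact: ia.
Qed.

Lemma L2_integrable_sqr g : L2 P g -> P.-integrable setT (fun x => ((g x) ^+ 2)%:E).
Proof.
move=> [mg ig]; apply/integrableP; split.
  by apply/measurable_EFinP; exact: measurable_funX.
by under eq_integral do rewrite gee0_abs//.
Qed.

Lemma L2_intro g : measurable_fun setT g ->
  P.-integrable setT (fun x => ((g x) ^+ 2)%:E) -> L2 P g.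
Proof.
move=> mg /integrableP[_]; split => //; move: b.
by under eq_integral do rewrite gee0_abs//.
Qed.

Lemma L2_integrable g h : L2 P g -> L2 P h ->
  P.-integrable setT (EFin \o (fun x => g x * h x)).
Proof.
move=> Lg Lh; have [mg _] := Lg; have [mh _] := Lh.
apply: (@le_integrable _ _ _ P setT measurableT _
  (fun x => ((g x) ^+ 2)%:E + ((h x) ^+ 2)%:E)%E).
- by apply/measurable_EFinP; exact: measurable_funM.
- move=> x _; rewrite -EFinD !abse_EFin lee_fin normrM.
  rewrite (ger0_norm (addr_ge0 (sqr_ge0 _) (sqr_ge0 _))).
  rewrite -(real_normK (num_real (g x))) -(real_normK (num_real (h x))).
  have := sqr_ge0 (`|g x| - `|h x|); have := sqr_ge0 (`|g x| + `|h x|); lra.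
- by apply: integrableD => //; exact: L2_integrable_sqr.
Qed.

Lemma l2_finite_L2 a k : l2_finite a -> L2 P (a k).
Proof.
move=> [ma ia]; split => //; apply: le_lt_trans ia.
apply: ge0_le_integral => //.
- by apply/measurable_EFinP; exact: measurable_funX.
- exact: measurable_nneseries_sqr.
- move=> x _; apply: (le_trans _ (nneseries_lim_ge (m := 0) k.+1 _)) => //.
  by rewrite big_nat_recr//= leeDr// sume_ge0.
Qed.

(** [|a b| <= a^2 + b^2] bounds all partial sums by one integrable function, which gives absolute
    convergence almost everywhere and then dominated convergence. *)
Lemma inner_spec a b : l2_finite a -> l2_finite b ->
  [/\ {ae P, forall x, (fun n => \sum_(0 <= k < n) (a k x * b k x)) @ \oo --> inner a b x},
   P.-integrable setT (EFin \o inner a b) &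
   (fun n => \sum_(0 <= k < n) \int[P]_x (a k x * b k x)) @ \oo
      --> \int[P]_x (inner a b x)].
Proof.
move=> la lb; have [ma _] := la; have [mb _] := lb.
have ia := l2_finite_integrable la; have ib := l2_finite_integrable lb.
pose A x := (\sum_(0 <= k <oo) ((a k x) ^+ 2)%:E)%E.
pose B x := (\sum_(0 <= k <oo) ((b k x) ^+ 2)%:E)%E.
have iAB : P.-integrable setT (A \+ B)%E by exact: integrableD.
have dom n x : ((\sum_(0 <= k < n) `|a k x * b k x|)%:E <= A x + B x)%E.
  apply: (@le_trans _ _ (\sum_(0 <= k < n) ((a k x) ^+ 2)%:E +
     \sum_(0 <= k < n) ((b k x) ^+ 2)%:E)%E); last first.
    by apply: leeD; apply: nneseries_lim_ge.
  rewrite -big_split /= -sumEFin; apply: lee_sum => k _.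
  rewrite -EFinD lee_fin normrM -(real_normK (num_real (a k x))) -(real_normK (num_real (b k x))).
  have := sqr_ge0 (`|a k x| - `|b k x|); have := sqr_ge0 (`|a k x| + `|b k x|); lra.
have cv : {ae P, forall x, (fun n => \sum_(0 <= k < n) (a k x * b k x)) @ \oo --> inner a b x}.
  have := integrable_ae measurableT iAB; apply: filterS => x /(_ I) ABx.
  apply: (@normed_cvg _ _ (fun k => a k x * b k x)).
  apply: nondecreasing_is_cvgn.
    by apply/nondecreasing_seqP => n; rewrite -subr_ge0 (seriesSB (fun k => `|_|)).
  exists (fine (A x + B x)) => _ [n _ <-]; rewrite /series/=.
  by rewrite -lee_fin fineK//; exact: dom.
have mP n : measurable_fun setT (fun x => (\sum_(0 <= k < n) (a k x * b k x))%:E).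
  apply/measurable_EFinP; apply: measurable_sum => k; exact: measurable_funM.
have [|||i1 _ i2] := @dominated_convergence _ _ _ P setT measurableT
  (fun n x => (\sum_(0 <= k < n) (a k x * b k x))%:E) (EFin \o inner a b) _ mP _ _ iAB.
- by apply/measurable_EFinP; exact: measurable_inner.
- apply: filterS cv => x cvx _; apply: cvg_EFin; first exact: nearW.
  exact: cvx.
- apply: aeW => x n _ /=; apply: le_trans (dom n x).
  by rewrite lee_fin ler_norm_sum.
split => //.
have E : (\int[P]_x (inner a b x)%:E = (\int[P]_x inner a b x)%:E)%E.
  by rewrite /Rintegral fineK//; exact: integrable_fin_num.
move: i2; rewrite E => /fine_cvgP[_]; apply: cvg_trans; apply: near_eq_cvg.
apply: nearW => n /=; rewrite /Rintegral.
under eq_integral do rewrite -sumEFin.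
rewrite integral_sum//; last by move=> k; apply: L2_integrable; exact: l2_finite_L2.
rewrite -sum_fine// => k _; apply: integrable_fin_num => //.
by apply: L2_integrable; exact: l2_finite_L2.
Qed.

Lemma L2Z c g : L2 P g -> L2 P (fun x => c * g x).
Proof.
move=> Lg; have [mg _] := Lg; apply: L2_intro; first exact: measurable_funM.
have := integrableZl measurableT (c ^+ 2) (L2_integrable_sqr Lg).
by apply: eq_integrable => // x _; rewrite -EFinM exprMn.
Qed.

Lemma L2D g h : L2 P g -> L2 P h -> L2 P (fun x => g x + h x).
Proof.
move=> Lg Lh; have [mg _] := Lg; have [mh _] := Lh.
apply: L2_intro; first exact: measurable_funD.
have := integrableD measurableT (integrableD measurableT (L2_integrable_sqr Lg)
  (L2_integrable_sqr Lh)) (integrableZl measurableT 2 (L2_integrable Lg Lh)).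
apply: eq_integrable => // x _.
by rewrite /= -EFinM -!EFinD; congr (_%:E); ring.
Qed.

Lemma L2B g h : L2 P g -> L2 P h -> L2 P (fun x => g x - h x).
Proof.
move=> Lg Lh; rewrite (_ : (fun x => _) = (fun x => g x + -1 * h x)).
  by apply: L2D => //; exact: L2Z.
by apply/funext => x; rewrite mulN1r.
Qed.

Lemma L2_cst c : L2 P (cst c).
Proof.
split; first exact: measurable_cst.
by rewrite /cst/= integral_cst//= [X in (_ * X)%E](@probability_setT _ _ _ P) mule1 ltry.
Qed.

Lemma L2_integrable1 g : L2 P g -> P.-integrable setT (EFin \o g).
Proof.
move=> Lg; have := L2_integrable (L2_cst 1) Lg.
by apply: eq_integrable => // x _ /=; rewrite /cst mul1r.
Qed.

(* AM-GM with a free weight, replacing the Cauchy-Schwarz inequality *)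
Lemma L2_mul_le g h c : 0 < c -> L2 P g -> L2 P h ->
  `|\int[P]_x (g x * h x)| <=
  c / 2 * \int[P]_x (g x ^+ 2) + (2 * c)^-1 * \int[P]_x (h x ^+ 2).
Proof.
move=> c0 Lg Lh.
apply: (le_trans (le_normr_Rintegral measurableT (L2_integrable Lg Lh))).
rewrite -!RintegralZl//; try exact: L2_integrable_sqr.
have i1 : P.-integrable setT (EFin \o (fun x => c / 2 * g x ^+ 2)).
  exact: (integrableZl measurableT (c / 2) (L2_integrable_sqr Lg)).
have i2 : P.-integrable setT (EFin \o (fun x => (2 * c)^-1 * h x ^+ 2)).
  exact: (integrableZl measurableT (2 * c)^-1 (L2_integrable_sqr Lh)).
rewrite -RintegralD//; apply: le_Rintegral => //.
- exact: integrable_norm (L2_integrable Lg Lh).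
- exact: (integrableD measurableT i1 i2).
move=> x _.
rewrite normrM -(real_normK (num_real (g x))) -(real_normK (num_real (h x))).
set u := `|_|; set v := `|_|.
rewrite -subr_ge0 (_ : _ - _ = (2 * c)^-1 * (c * u - v) ^+ 2); last first.
  by field; rewrite gt_eqF.
by rewrite mulr_ge0 ?sqr_ge0// invr_ge0 mulr_ge0// ltW.
Qed.

End square_integrable.

(** * Chaos sums *)

Section chaos.
Context {R : realType} {d : measure_display} {T : measurableType d}.
Context (P : probability T R) (X : nat -> T -> R) (p : nat -> R).
Hypothesis HX : rademacher_family P X p.
Implicit Types (g h : (nat -> R) -> R) (v : nat -> R).

Let s k := Num.sqrt (p k * q_ p k).
Let s_gt0 k : 0 < s k.
Proof. by rewrite sqrtr_gt0 mulr_gt0// ?(p_gt0 HX) ?(q_gt0 HX). Qed.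

Definition yk k (x : R) : R := (x - p k + q_ p k) / (2 * s k).

(* Summand of the number operator [-L = \sum_k Y_k D_k]. *)
Definition num_part k g v := yk k (v k) * (s k * (g (upd v k 1) - g (upd v k (-1)))).

Lemma yk_diff k : s k * (yk k 1 - yk k (-1)) = 1.
Proof. by rewrite /yk; field; rewrite gt_eqF. Qed.

Lemma upd_upd v k x y : upd (upd v k x) k y = upd v k y.
Proof. by apply/funext => j; rewrite /upd; case: eqP. Qed.

Lemma gmeasurable_coord k (h : R -> R) : measurable_fun setT h ->
  gmeasurable (fun v => h (v k)).
Proof.
move=> mh B mB; apply: sub_sigma_algebra; exists k, (h @^-1` B); split => //.
by rewrite -[X in measurable X]setTI; exact: mh.
Qed.

Lemma measurable_yk k : measurable_fun setT (yk k).
Proof.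
apply: measurable_funM => //; apply: measurable_funD => //.
exact: measurable_funB.
Qed.

Lemma gmeasurable_upd_fun g k a : gmeasurable g ->
  gmeasurable (fun v => g (upd v k a)).
Proof.
move=> /gmeasurableP mg; apply/gmeasurableP.
apply: (measurableT_comp mg); apply: measurable_fun_seq => j; rewrite /upd.
case: (j == k); first exact: measurable_cst.
by apply/gmeasurableP; exact: (gmeasurable_coord j (@measurable_id _ _ setT)).
Qed.

Lemma gmeasurableM g h : gmeasurable g -> gmeasurable h ->
  gmeasurable (fun v => g v * h v).
Proof.
by move=> /gmeasurableP mg /gmeasurableP mh; apply/gmeasurableP; exact: measurable_funM.
Qed.

Lemma gmeasurableB g h : gmeasurable g -> gmeasurable h ->
  gmeasurable (fun v => g v - h v).
Proof.
by move=> /gmeasurableP mg /gmeasurableP mh; apply/gmeasurableP; exact: measurable_funB.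
Qed.

Lemma gmeasurable_cst (c : R) : gmeasurable (fun _ : nat -> R => c).
Proof. by apply/gmeasurableP; exact: measurable_cst. Qed.

Lemma measurable_Dk g k : gmeasurable g -> measurable_fun setT (Dk X p g k).
Proof.
move=> mg; apply: measurable_funM => //.
by apply: measurable_funB; exact: (gmeasurable_upd HX).
Qed.

Lemma L2_Dk g k : gmeasurable g -> L2 P (rv X g) -> L2 P (Dk X p g k).
Proof.
move=> mg [_ Lg]; split; first exact: measurable_Dk.
exact: le_lt_trans (Dk_resample_sqr HX k mg) Lg.
Qed.

Lemma gmeasurable_num_part k g : gmeasurable g -> gmeasurable (num_part k g).
Proof.
move=> mg; apply: gmeasurableM; first exact: (gmeasurable_coord k (measurable_yk k)).
apply: gmeasurableM; first exact: gmeasurable_cst.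
by apply: gmeasurableB; exact: gmeasurable_upd_fun.
Qed.

Lemma num_part_upd k g x a :
  num_part k g (upd (Xvec X x) k a) = yk k a * Dk X p g k x.
Proof. by rewrite /num_part !upd_upd /upd eqxx. Qed.

Let s_sqr k : s k * s k = p k * q_ p k.
Proof.
rewrite -expr2 sqr_sqrtr// mulr_ge0// ltW//.
  exact: p_gt0 HX k.
exact: q_gt0 HX k.
Qed.

(** With [q_yk]: redrawing coordinate [k] under a factor [Y_k] puts the weights [s k] and [- s k] on
    its two values, and these are the coefficients of [D_k]. *)
Lemma p_yk k : p k * yk k 1 = s k.
Proof.
have sn0 : s k != 0 by rewrite gt_eqF.
apply: (mulIf sn0); rewrite s_sqr /yk /q_; field; exact: sn0.
Qed.

Lemma q_yk k : q_ p k * yk k (-1) = - s k.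
Proof.
have sn0 : s k != 0 by rewrite gt_eqF.
apply: (mulIf sn0); rewrite mulNr s_sqr /yk /q_; field; exact: sn0.
Qed.

(** [yk k] is unbounded as a function of a real argument; redrawing coordinate [k], which [g] does
    not see, replaces it by two constants. *)
Lemma L2_yk_mul k g : gmeasurable g -> L2 P (rv X g) ->
  (forall v a, g (upd v k a) = g v) -> L2 P (rv X (fun v => yk k (v k) * g v)).
Proof.
move=> mg Lg gk.
have mn : gmeasurable (fun v => yk k (v k) * g v).
  by apply: gmeasurableM => //; exact: (gmeasurable_coord k (measurable_yk k)).
split; first exact: (gmeasurable_Xvec HX).
have mn2 : gmeasurable (fun v => (yk k (v k) * g v) ^+ 2).
  by apply/gmeasurableP; apply: measurable_funX; exact/gmeasurableP.
rewrite (ge0_integral_resample HX k mn2); last by move=> v; exact: sqr_ge0.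
have E a : (\int[P]_x ((yk k (upd (Xvec X x) k a k) * g (upd (Xvec X x) k a)) ^+ 2)%:E < +oo)%E.
  have [_] := L2Z (yk k a) Lg; congr (_ < _)%E.
  by apply: eq_integral => x _; rewrite gk /upd eqxx.
apply: lte_add_pinfty; apply: lte_mul_pinfty => //; rewrite lee_fin ltW//.
  exact: p_gt0 HX k.
exact: q_gt0 HX k.
Qed.

Lemma L2_num_part g k : gmeasurable g -> L2 P (rv X g) ->
  L2 P (rv X (num_part k g)).
Proof.
move=> mg Lg; apply: (L2_yk_mul _ (L2_Dk k mg Lg)).
  apply: gmeasurableM; first exact: gmeasurable_cst.
  by apply: gmeasurableB; exact: gmeasurable_upd_fun.
by move=> v a; rewrite !upd_upd.
Qed.

(** [D_k g] does not depend on coordinate [k], so redrawing it leaves [D_k g] fixed and averages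
    [h Y_k] to [D_k h]. *)
Lemma num_part_ibp h g k : gmeasurable h -> gmeasurable g ->
  L2 P (rv X h) -> L2 P (rv X g) ->
  \int[P]_x (rv X h x * rv X (num_part k g) x) =
  \int[P]_x (Dk X p h k x * Dk X p g k x).
Proof.
move=> mh mg Lh Lg.
have mhn := gmeasurableM mh (gmeasurable_num_part k mg).
have [i1 i2 E] := integrable_resample HX k mhn (L2_integrable Lh (L2_num_part k mg Lg)).
apply: (etrans E); rewrite -!RintegralZl// -RintegralD//; first last.
- exact: (integrableZl measurableT (q_ p k) i2).
- exact: (integrableZl measurableT (p k) i1).
apply: eq_Rintegral => x _; rewrite !num_part_upd.
transitivity ((p k * yk k 1) * (h (upd (Xvec X x) k 1) * Dk X p g k x) +
  (q_ p k * yk k (-1)) * (h (upd (Xvec X x) k (-1)) * Dk X p g k x)); first ring.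
rewrite p_yk q_yk [X in _ = X * _]/Dk -/(s k); ring.
Qed.

Definition monomial n N (t : n.-tuple 'I_N) v := \prod_(i <- t) yk (val i) (v (val i)).

(** [Jn] as a function of the sequence instead of the sample point, so that [D_k] can act on it. *)
Definition chaos_term n N (fn : seq nat -> R) v :=
  \sum_(t : n.-tuple 'I_N | uniq t) fn (map val t) * monomial t v.

(* On a monomial [Y_k D_k] is the identity or zero, according to whether [Y_k] occurs. *)
Lemma num_part_monomial n N (t : n.-tuple 'I_N) (k : 'I_N) v : uniq t ->
  num_part k (monomial t) v = if k \in t then monomial t v else 0.
Proof.
move=> ut; rewrite /num_part /monomial; case: ifPn => kt.
  have rest x : \prod_(i <- t | i != k) yk (val i) (upd v k x (val i)) =
      \prod_(i <- t | i != k) yk (val i) (v (val i)).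
    apply: eq_bigr => i ik; rewrite /upd; case: eqP => // /val_inj ik'.
    by rewrite ik' eqxx in ik.
  rewrite !(bigD1_seq k) //= !rest /upd eqxx -mulrBl [s k * _]mulrA yk_diff mul1r.
  by [].
suff E x : \prod_(i <- t) yk (val i) (upd v k x (val i)) = \prod_(i <- t) yk (val i) (v (val i)).
  by rewrite !E subrr !mulr0.
rewrite big_seq [RHS]big_seq; apply: eq_bigr => i it; rewrite /upd; case: eqP => // /val_inj ik.
by rewrite -ik it in kt.
Qed.

Lemma sum_num_part_monomial n N (t : n.-tuple 'I_N) v : uniq t ->
  \sum_(k < N) num_part k (monomial t) v = n%:R * monomial t v.
Proof.
move=> ut; under eq_bigr do rewrite num_part_monomial//.
rewrite -big_mkcond/= sumr_const (card_uniqP ut) size_tuple mulr_natl//.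
Qed.

Lemma num_part_sum k (I : Type) (r : seq I) (Q : pred I) (c : I -> R)
    (g : I -> (nat -> R) -> R) v :
  num_part k (fun v => \sum_(i <- r | Q i) c i * g i v) v =
  \sum_(i <- r | Q i) c i * num_part k (g i) v.
Proof.
rewrite /num_part -sumrB !mulr_sumr; apply: eq_bigr => i _.
ring.
Qed.

Lemma sum_num_part_chaos_term n N fn v :
  \sum_(k < N) num_part k (chaos_term n N fn) v = n%:R * chaos_term n N fn v.
Proof.
under eq_bigr do rewrite num_part_sum.
rewrite exchange_big /= mulr_sumr; apply: eq_bigr => t ut.
by rewrite -mulr_sumr sum_num_part_monomial// mulrCA.
Qed.

Definition chaos_sum N (fs : nat -> seq nat -> R) v := \sum_(1 <= n < N.+1) chaos_term n N (fs n) v.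
Definition Linv_sum N (fs : nat -> seq nat -> R) v :=
  - \sum_(1 <= n < N.+1) n%:R^-1 * chaos_term n N (fs n) v.

Lemma sum_num_part_Linv_sum N fs v : \sum_(k < N) num_part k (Linv_sum N fs) v = - chaos_sum N fs v.
Proof.
have E k : num_part k (Linv_sum N fs) v =
    - \sum_(1 <= n < N.+1) n%:R^-1 * num_part k (chaos_term n N (fs n)) v.
  by rewrite -num_part_sum /num_part /Linv_sum; ring.
under eq_bigr do rewrite E.
rewrite sumrN exchange_big/=; congr (- _).
rewrite big_nat [RHS]big_nat; apply: eq_bigr => n /andP[n0 _].
by rewrite -mulr_sumr sum_num_part_chaos_term mulKf// pnatr_eq0 -lt0n.
Qed.

Lemma gmeasurable_sum (I : Type) (r : seq I) (Q : pred I) (g : I -> (nat -> R) -> R) :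
  (forall i, gmeasurable (g i)) -> gmeasurable (fun v => \sum_(i <- r | Q i) g i v).
Proof.
move=> mg; apply/gmeasurableP; rewrite (_ : (fun v => _) =
  (fun v => \sum_(i <- [seq i <- r | Q i]) g i v)); last first.
  by apply/funext => v; rewrite big_filter.
by apply: measurable_sum => i; exact/gmeasurableP.
Qed.

Lemma gmeasurable_monomial n N (t : n.-tuple 'I_N) : gmeasurable (monomial t).
Proof.
rewrite /monomial; elim: (tval t) => [|i r IH].
  rewrite (_ : (fun v => _) = fun=> 1); first exact: gmeasurable_cst.
  by apply/funext => v; rewrite big_nil.
rewrite (_ : (fun v => _) = fun v => yk (val i) (v (val i)) *
    \prod_(i <- r) yk (val i) (v (val i))).
  by apply: gmeasurableM => //; exact: (gmeasurable_coord _ (measurable_yk (val i))).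
by apply/funext => v; rewrite big_cons.
Qed.

Lemma gmeasurable_chaos_term n N fn : gmeasurable (chaos_term n N fn).
Proof.
apply: gmeasurable_sum => t; apply: gmeasurableM; first exact: gmeasurable_cst.
exact: gmeasurable_monomial.
Qed.

(** Indices do not repeat, so at each step the new factor multiplies a function that does not depend
    on its coordinate. *)
Lemma L2_monomial n N (t : n.-tuple 'I_N) : uniq t -> L2 P (rv X (monomial t)).
Proof.
suff H (r : seq 'I_N) : uniq r ->
    gmeasurable (fun v => \prod_(i <- r) yk (val i) (v (val i))) /\
    L2 P (rv X (fun v => \prod_(i <- r) yk (val i) (v (val i)))).
  by move=> /H[].
elim: r => [_|i r IH /= /andP[ir ur]].
  rewrite (_ : (fun v => _) = fun=> 1); first by split; [exact: gmeasurable_cst|exact: L2_cst].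
  by apply/funext => v; rewrite big_nil.
have [mr Lr] := IH ur.
rewrite (_ : (fun v => _) = fun v => yk (val i) (v (val i)) *
    \prod_(i <- r) yk (val i) (v (val i))); last first.
  by apply/funext => v; rewrite big_cons.
split.
  by apply: gmeasurableM => //; exact: (gmeasurable_coord _ (measurable_yk (val i))).
apply: L2_yk_mul => // v a; rewrite big_seq [RHS]big_seq; apply: eq_bigr => j jr.
by rewrite /upd; case: eqP => // /val_inj ji; rewrite -ji jr in ir.
Qed.

Lemma L2_sum (I : Type) (r : seq I) (Q : pred I) (g : I -> (nat -> R) -> R) :
  (forall i, Q i -> L2 P (rv X (g i))) ->
  L2 P (rv X (fun v => \sum_(i <- r | Q i) g i v)).
Proof.
move=> Lg; elim: r => [|i r IH].
  rewrite (_ : rv _ _ = cst 0); first exact: L2_cst.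
  by apply/funext => x; rewrite /rv big_nil.
rewrite (_ : rv _ _ = fun x => (if Q i then rv X (g i) x else 0) +
    rv X (fun v => \sum_(i <- r | Q i) g i v) x).
  apply: L2D => //; have [/Lg//|_] := boolP (Q i); exact: L2_cst.
apply/funext => x; rewrite /rv big_cons; case: ifP => //; by rewrite add0r.
Qed.

Lemma L2_chaos_term n N fn : L2 P (rv X (chaos_term n N fn)).
Proof.
by apply: L2_sum => t ut; apply: L2Z; exact: L2_monomial.
Qed.

Lemma L2_chaos_sum N fs : L2 P (rv X (chaos_sum N fs)).
Proof. by apply: L2_sum => n _; exact: L2_chaos_term. Qed.

Lemma L2_Linv_sum N fs : L2 P (rv X (Linv_sum N fs)).
Proof.
rewrite (_ : rv _ _ = fun x => -1 *
    rv X (fun v => \sum_(1 <= n < N.+1) n%:R^-1 * chaos_term n N (fs n) v) x).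
  by apply: L2Z; apply: L2_sum => n _; apply: L2Z; exact: L2_chaos_term.
by apply/funext => x; rewrite mulN1r.
Qed.

Lemma gmeasurable_chaos_sum N fs : gmeasurable (chaos_sum N fs).
Proof. by apply: gmeasurable_sum => n; exact: gmeasurable_chaos_term. Qed.

Lemma gmeasurable_Linv_sum N fs : gmeasurable (Linv_sum N fs).
Proof.
rewrite (_ : Linv_sum N fs = fun v => 0 - \sum_(1 <= n < N.+1) n%:R^-1 * chaos_term n N (fs n) v).
  apply: gmeasurableB; first exact: gmeasurable_cst.
  apply: gmeasurable_sum => n; apply: gmeasurableM; first exact: gmeasurable_cst.
  exact: gmeasurable_chaos_term.
by apply/funext => v; rewrite sub0r.
Qed.

(** The truncation involves only coordinates below [N], so the operators [Y_k D_k] with [k < N] make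
    up the whole number operator on it. *)
Lemma truncated_ibp N fs h : gmeasurable h -> L2 P (rv X h) ->
  \int[P]_x (rv X h x * rv X (chaos_sum N fs) x) =
  - \sum_(k < N) \int[P]_x (Dk X p h k x * Dk X p (Linv_sum N fs) k x).
Proof.
move=> mh Lh; have mt := gmeasurable_Linv_sum N fs; have Lt := L2_Linv_sum N fs.
under eq_bigr do rewrite -num_part_ibp//.
rewrite (_ : (fun x => rv X h x * rv X (chaos_sum N fs) x) =
   (fun x => -1 * \sum_(k < N) (rv X h x * rv X (num_part k (Linv_sum N fs)) x))); last first.
  apply/funext => x; rewrite -mulr_sumr mulN1r -mulrN; congr (_ * _).
  by rewrite -[LHS]opprK -sum_num_part_Linv_sum.
have ik (k : 'I_N) : P.-integrable setT
    (fun x => (rv X h x * rv X (num_part k (Linv_sum N fs)) x)%:E).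
  by apply: L2_integrable => //; exact: L2_num_part.
have is_ : P.-integrable setT
    (EFin \o (fun x => \sum_(k < N) (rv X h x * rv X (num_part k (Linv_sum N fs)) x))).
  have := @integrable_sum _ _ _ P setT measurableT _ (index_enum 'I_N) predT
    (fun k x => (rv X h x * rv X (num_part k (Linv_sum N fs)) x)%:E) (fun k _ => ik k).
  by apply: eq_integrable => // x _; rewrite /= sumEFin.
rewrite RintegralZl// mulN1r; congr (- _).
rewrite /Rintegral sum_fine; last by move=> k _; exact: integrable_fin_num.
congr fine; rewrite -integral_sum//.
by apply: eq_integral => x _; rewrite sumEFin.
Qed.

End chaos.

(** * Integration by parts for the inverse of L *)

Section limit.
Context {R : realType} {d : measure_display} {T : measurableType d}.
Context (P : probability T R) (X : nat -> T -> R) (p : nat -> R).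
Hypothesis HX : rademacher_family P X p.
Implicit Types (g h : (nat -> R) -> R) (v : nat -> R).

Local Notation E2 u := (\int[P]_x ((u x) ^+ 2)).

Lemma E2_fine u : L2 P u -> (\int[P]_x ((u x) ^+ 2)%:E = (E2 u)%:E)%E.
Proof.
by move=> Lu; rewrite /Rintegral fineK// integrable_fin_num//; exact: L2_integrable_sqr.
Qed.

Lemma E2_ge0 (u : T -> R) : 0 <= E2 u.
Proof. by apply: Rintegral_ge0 => x _; exact: sqr_ge0. Qed.

Lemma E2D_le u w : L2 P u -> L2 P w ->
  E2 (fun x => u x + w x) <= 2 * E2 u + 2 * E2 w.
Proof.
move=> Lu Lw.
have iu : P.-integrable setT (EFin \o (fun x => 2 * u x ^+ 2)).
  exact: (integrableZl measurableT 2 (L2_integrable_sqr Lu)).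
have iw : P.-integrable setT (EFin \o (fun x => 2 * w x ^+ 2)).
  exact: (integrableZl measurableT 2 (L2_integrable_sqr Lw)).
rewrite -!RintegralZl//; try exact: L2_integrable_sqr.
rewrite -RintegralD//; apply: le_Rintegral => //.
- exact: L2_integrable_sqr (L2D Lu Lw).
- exact: (integrableD measurableT iu iw).
by move=> x _; have := sqr_ge0 (u x - w x); lra.
Qed.

Lemma E2B_le u w : L2 P u -> L2 P w ->
  E2 (fun x => u x - w x) <= 2 * E2 u + 2 * E2 w.
Proof.
move=> Lu Lw; have := E2D_le Lu (L2Z (-1) Lw).
under [X in X <= _ -> _]eq_Rintegral do rewrite mulN1r.
by under [X in _ <= _ + 2 * X -> _]eq_Rintegral do rewrite mulN1r sqrrN.
Qed.

Lemma ler_sum_natl (u : nat -> R) K N : (K <= N)%N -> (forall k, 0 <= u k) ->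
  \sum_(0 <= k < K) u k <= \sum_(0 <= k < N) u k.
Proof.
move=> KN u0; rewrite (big_cat_nat (leq0n K) KN)/= lerDl.
by apply: sumr_ge0.
Qed.

Lemma E2_Dk_le k g : gmeasurable g -> L2 P (rv X g) -> E2 (Dk X p g k) <= E2 (rv X g).
Proof.
move=> mg Lg; rewrite -lee_fin -!E2_fine//; last exact: (L2_Dk HX).
exact: (Dk_resample_sqr HX k mg).
Qed.

Lemma DkB g h k x : Dk X p (fun v => g v - h v) k x = Dk X p g k x - Dk X p h k x.
Proof. by rewrite /Dk; ring. Qed.

(** An extended integral tending to 0 is finite from some rank on; from there its real value can be
    used. *)
Lemma L2cvg_real (u : nat -> T -> R) w :
  (forall N, measurable_fun setT (u N)) -> measurable_fun setT w -> L2cvg P u w ->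
  (\forall N \near \oo, L2 P (fun x => u N x - w x)) /\
  (fun N => E2 (fun x => u N x - w x)) @ \oo --> (0 : R).
Proof.
move=> mu mw /fine_cvgP[fin cv]; split => //.
apply: filterS fin => N; rewrite ge0_fin_numE; last first.
  by apply: integral_ge0 => x _; rewrite lee_fin sqr_ge0.
by split => //; exact: measurable_funB.
Qed.

Section Linv.
Variables (f G : (nat -> R) -> R).
Hypothesis (mf : gmeasurable f) (Lf : L2 P (rv X f)).
Hypothesis Hmean : (\int[P]_x (rv X f x)%:E = 0)%E.
Hypothesis HG : is_Linv P X p f G.

Let mG : gmeasurable G. Proof. by case: HG. Qed.

(** The square-integrability of [G] comes from one truncation that lies at finite L2 distance from
    it. *)
Lemma chaos_approx : exists fs,
  [/\ L2 P (rv X G),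
   (fun N => E2 (fun x => rv X (chaos_sum p N fs) x - rv X f x)) @ \oo --> (0 : R) &
   (fun N => E2 (fun x => rv X (Linv_sum p N fs) x - rv X G x)) @ \oo --> (0 : R)].
Proof.
case: HG => _ [fs [cF cG]]; exists fs.
have [|||_ cF'] := @L2cvg_real (fun N => rv X (chaos_sum p N fs)) (rv X f).
- by move=> N; exact: (gmeasurable_Xvec HX (gmeasurable_chaos_sum p N fs)).
- exact: (gmeasurable_Xvec HX).
- move: cF; rewrite /chaos_expansion Hmean /L2cvg /=.
  apply: cvg_trans; apply: near_eq_cvg; apply: nearW => N.
  by apply: eq_integral => x _; rewrite add0r.
have [|||nG cG'] := @L2cvg_real (fun N => rv X (Linv_sum p N fs)) (rv X G).
- by move=> N; exact: (gmeasurable_Xvec HX (gmeasurable_Linv_sum p N fs)).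
- exact: (gmeasurable_Xvec HX).
- exact: cG.
split => //.
have [N LN] : exists N, L2 P (fun x => rv X (Linv_sum p N fs) x - rv X G x).
  by case: nG => N _ HN; exists N; exact: (HN N (leqnn N)).
rewrite (_ : rv X G = fun x => rv X (Linv_sum p N fs) x - (rv X (Linv_sum p N fs) x - rv X G x)).
  exact: (L2B (L2_Linv_sum HX N fs) LN).
by apply/funext => x; ring.
Qed.

Lemma Linv_L2 : L2 P (rv X G).
Proof. by have [fs []] := chaos_approx. Qed.

Lemma truncated_energy : exists fs C,
  [/\ (fun N => E2 (fun x => rv X (chaos_sum p N fs) x - rv X f x)) @ \oo --> (0 : R),
   (fun N => E2 (fun x => rv X (Linv_sum p N fs) x - rv X G x)) @ \oo --> (0 : R),
   0 <= C &
   \forall N \near \oo, \sum_(0 <= k < N) E2 (Dk X p (Linv_sum p N fs) k) <= C].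
Proof.
have [fs [LG cF cG]] := chaos_approx.
(* AM-GM on [- E[S U]] leaves half of [E[S^2] + E[U^2]]; each of these is at most twice the limiting
   value plus 2, once both squared L2 distances are below 1. *)
exists fs, (E2 (rv X f) + E2 (rv X G) + 2); split => //.
  by rewrite !addr_ge0 ?E2_ge0.
near=> N.
have eN : E2 (fun x => rv X (chaos_sum p N fs) x - rv X f x) <= 1.
  by near: N; apply: (cvgr_le 0).
have tN1 : E2 (fun x => rv X (Linv_sum p N fs) x - rv X G x) <= 1.
  by near: N; apply: (cvgr_le 0).
have LT := L2_Linv_sum HX N fs; have LS := L2_chaos_sum HX N fs.
have E := truncated_ibp HX N fs (gmeasurable_Linv_sum p N fs) LT.
rewrite big_mkord; under eq_bigr do under eq_Rintegral do rewrite expr2.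
rewrite -[leLHS]opprK -E.
have := L2_mul_le (c := 1) ltr01 LT LS; rewrite mulr1 ler_norml => /andP[+ _].
have := E2D_le Lf (L2B LS Lf); have := E2D_le LG (L2B LT LG).
under [X in X <= _ -> _]eq_Rintegral do rewrite addrC subrK.
under [X in _ -> X <= _ -> _]eq_Rintegral do rewrite addrC subrK.
lra.
Unshelve. all: by end_near. Qed.

(** Each finite sum over [k < K] is compared with a truncation [N >= K] so close to [G] that the [K]
    errors of size [2 * e] add up to at most 2. *)
Lemma Linv_l2_finite : l2_finite (P := P) (Dk X p G).
Proof.
have [fs [C [_ cG C0 nC]]] := truncated_energy.
have LG := Linv_L2.
split=> [k|]; first exact: (measurable_Dk HX).
have LDG k : L2 P (Dk X p G k) by exact: (L2_Dk HX).
rewrite integral_nneseries//; last 2 first.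
- move=> k; apply/measurable_EFinP; apply: measurable_funX.
  exact: (measurable_Dk HX).
- by move=> k x _; rewrite lee_fin sqr_ge0.
apply: (@le_lt_trans _ _ (2 * C + 2)%:E); last by rewrite ltry.
apply: lime_le.
  apply: is_cvg_nneseries => k _ _; apply: integral_ge0 => x _.
  by rewrite lee_fin sqr_ge0.
apply: nearW => K.
under eq_bigr do rewrite E2_fine//.
rewrite sumEFin lee_fin.
near \oo => N.
have KN : (K <= N)%N by near: N; exact: nbhs_infty_ge.
have HC : \sum_(0 <= k < N) E2 (Dk X p (Linv_sum p N fs) k) <= C by near: N.
set e := E2 (fun x => rv X (Linv_sum p N fs) x - rv X G x).
have He : e <= (K.+1%:R)^-1.
  by rewrite /e; near: N; apply: (cvgr_le 0) => //; rewrite invr_gt0.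
have mD : gmeasurable (fun v => Linv_sum p N fs v - G v).
  by apply: gmeasurableB => //; exact: gmeasurable_Linv_sum.
have LD : L2 P (rv X (fun v => Linv_sum p N fs v - G v)) by exact: L2B (L2_Linv_sum HX N fs) LG.
have LDT k : L2 P (Dk X p (Linv_sum p N fs) k).
  by apply: (L2_Dk HX); [exact: gmeasurable_Linv_sum|exact: (L2_Linv_sum HX)].
have step k : E2 (Dk X p G k) <= 2 * E2 (Dk X p (Linv_sum p N fs) k) + 2 * e.
  rewrite (_ : E2 (Dk X p G k) = E2 (fun x => Dk X p (Linv_sum p N fs) k x -
      Dk X p (fun v => Linv_sum p N fs v - G v) k x)); last first.
    by apply: eq_Rintegral => x _; rewrite DkB opprB addrC subrK.
  apply: le_trans (E2B_le (LDT k) (L2_Dk HX k mD LD)) _.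
  by rewrite lerD2l ler_wpM2l//; exact: E2_Dk_le.
apply: (@le_trans _ _ (\sum_(0 <= k < K) (2 * E2 (Dk X p (Linv_sum p N fs) k) + 2 * e))).
  by apply: ler_sum => k _.
rewrite big_split/= -mulr_sumr sumr_const_nat subn0.
have := ler_sum_natl KN (fun k => E2_ge0 (Dk X p (Linv_sum p N fs) k)).
have : e *+ K <= 1.
  apply: (@le_trans _ _ ((K.+1%:R)^-1 *+ K)); first by rewrite lerMn2r He orbT.
  by rewrite -[leLHS]mulr_natl ler_pdivrMr// mul1r ler_nat.
rewrite -mulrnAr; lra.
Unshelve. all: by end_near. Qed.

(** At truncation level [N] the identity is exact. For fixed [K] the terms [k < K] converge as [N]
    grows, while those with [K <= k < N] are small uniformly in [N]: [D_k h] is square-summable and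
    the energy of the truncations is bounded. *)
Lemma Linv_ibp h : D12 P X p h ->
  (fun n => \sum_(0 <= k < n) \int[P]_x (Dk X p h k x * - Dk X p G k x)) @ \oo
    --> \int[P]_x (rv X f x * rv X h x).
Proof.
move=> [mh Lh fh].
have [fs [C [cF cG C0 nC]]] := truncated_energy.
have LG := Linv_L2.
have LDG k : L2 P (Dk X p G k) by exact: (L2_Dk HX).
have LDh k : L2 P (Dk X p h k) by exact: (L2_Dk HX).
pose u k := E2 (Dk X p h k).
have u0 k : 0 <= u k by exact: E2_ge0.
have cu : cvgn (series u).
  apply: nondecreasing_is_cvgn.
    by apply/nondecreasing_seqP => n; apply: ler_sum_natl.
  exists (fine (\int[P]_x (\sum_(0 <= k <oo) ((Dk X p h k x) ^+ 2)%:E)%E)%E) => _ [n _ <-].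
  rewrite -lee_fin fineK; last first.
    rewrite ge0_fin_numE//; apply: integral_ge0 => x _.
    by apply: nneseries_ge0 => k _ _; rewrite lee_fin sqr_ge0.
  rewrite /series/= -sumEFin; under eq_bigr do rewrite -E2_fine//.
  rewrite integral_nneseries//; last 2 first.
  - move=> k; apply/measurable_EFinP; apply: measurable_funX.
    exact: (measurable_Dk HX).
  - by move=> k x _; rewrite lee_fin sqr_ge0.
  apply: nneseries_lim_ge => k _ _; apply: integral_ge0 => x _.
  by rewrite lee_fin sqr_ge0.
set U := limn (series u).
have leU n : series u n <= U.
  by apply: nondecreasing_cvgn_le => //; apply/nondecreasing_seqP => m; apply: ler_sum_natl.
have U0 : 0 <= U by apply: le_trans (leU 0%N); rewrite /series/= big_geq.
apply/cvgrPdist_le => eps eps0.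
(* [c'] is large enough for the energy term [C / (2 c')] and [c] small enough for the total of the
   terms with weight [c / 2] to stay below [eps / 4]. Then [K] is taken for the weight [c' / 2] and
   [N] for the weight [1 / (2 c)]. *)
pose c' := 2 * (C + 1) / eps.
have c'0 : 0 < c' by rewrite divr_gt0// mulr_gt0// ltr_wpDl.
pose B := E2 (rv X h) + U + 1.
have B0 : 0 < B by rewrite ltr_wpDl// addr_ge0// E2_ge0.
pose c := eps / (2 * B).
have c0 : 0 < c by rewrite divr_gt0// mulr_gt0.
have ic0 : 0 <= (2 * c)^-1 by rewrite invr_ge0; lra.
have ic'0 : 0 <= (2 * c')^-1 by rewrite invr_ge0; lra.
have hc0 : 0 <= c / 2 by lra.
have hc'0 : 0 <= c' / 2 by lra.
have e2c : 0 < eps / (2 * c') by rewrite divr_gt0// mulr_gt0.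
have nK : \forall K \near \oo, `|U - series u K| <= eps / (2 * c').
  by move/cvgrPdist_le : cu; exact.
near=> K.
have tailK : U - series u K <= eps / (2 * c').
  have : `|U - series u K| <= eps / (2 * c').
    by near: K.
  exact: le_trans (ler_norm _).
have small : 0 < eps * c / (4 * K.+1%:R) by rewrite divr_gt0// mulr_gt0.
near \oo => N.
have KN : (K <= N)%N by near: N; exact: nbhs_infty_ge.
have HC : \sum_(0 <= k < N) E2 (Dk X p (Linv_sum p N fs) k) <= C by near: N.
set e := E2 (fun x => rv X (Linv_sum p N fs) x - rv X G x).
set e' := E2 (fun x => rv X (chaos_sum p N fs) x - rv X f x).
have He : e <= eps * c / (4 * K.+1%:R).
  rewrite /e; near: N; exact: (cvgr_le 0 cG _ small).
have He' : e' <= eps * c / (4 * K.+1%:R).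
  rewrite /e'; near: N; exact: (cvgr_le 0 cF _ small).
have LT := L2_Linv_sum HX N fs; have LS := L2_chaos_sum HX N fs.
have mT := gmeasurable_Linv_sum p N fs.
have LDT k : L2 P (Dk X p (Linv_sum p N fs) k) by exact: (L2_Dk HX).
have mD : gmeasurable (fun v => Linv_sum p N fs v - G v) by exact: gmeasurableB.
have LD : L2 P (rv X (fun v => Linv_sum p N fs v - G v)) by exact: L2B LT LG.
pose a k := \int[P]_x (Dk X p h k x * Dk X p G k x).
pose aN k := \int[P]_x (Dk X p h k x * Dk X p (Linv_sum p N fs) k x).
have E1 : \int[P]_x (rv X h x * rv X (chaos_sum p N fs) x) = - \sum_(0 <= k < N) aN k.
  by rewrite big_mkord; exact: truncated_ibp.
have E2' : \sum_(0 <= k < K) \int[P]_x (Dk X p h k x * - Dk X p G k x) =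
    - \sum_(0 <= k < K) a k.
  rewrite -sumrN; apply: eq_bigr => k _; rewrite /a -mulN1r -RintegralZl//.
    by apply: eq_Rintegral => x _; rewrite mulN1r mulrN.
  exact: L2_integrable.
rewrite E2'.
have I3 : `|\int[P]_x (rv X h x * rv X (chaos_sum p N fs) x) - \int[P]_x (rv X f x * rv X h x)|
    <= c / 2 * E2 (rv X h) + (2 * c)^-1 * e'.
  rewrite (_ : _ - _ = \int[P]_x (rv X h x * (rv X (chaos_sum p N fs) x - rv X f x))).
    by apply: L2_mul_le => //; exact: L2B.
  rewrite -RintegralB//; try exact: L2_integrable.
  by apply: eq_Rintegral => x _; ring.
have I1 k : `|aN k - a k| <= c / 2 * u k + (2 * c)^-1 * e.
  rewrite (_ : _ - _ = \int[P]_x (Dk X p h k x * Dk X p (fun v => Linv_sum p N fs v - G v) k x)).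
    apply: (le_trans (L2_mul_le c0 (LDh k) (L2_Dk HX k mD LD))).
    rewrite lerD2l ler_wpM2l//.
    exact: E2_Dk_le.
  rewrite -RintegralB//; try exact: L2_integrable.
  by apply: eq_Rintegral => x _; rewrite DkB; ring.
have I2 k : `|aN k| <= c' / 2 * u k + (2 * c')^-1 * E2 (Dk X p (Linv_sum p N fs) k).
  exact: L2_mul_le.
have S1 : `|\sum_(0 <= k < K) aN k - \sum_(0 <= k < K) a k| <=
    c / 2 * U + (2 * c)^-1 * (e *+ K).
  rewrite -sumrB; apply: (le_trans (ler_norm_sum _ _ _)).
  apply: (@le_trans _ _ (\sum_(0 <= k < K) (c / 2 * u k + (2 * c)^-1 * e))).
    by apply: ler_sum => k _.
  rewrite big_split/= -mulr_sumr sumr_const_nat subn0 -mulrnAr lerD2r.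
  by rewrite ler_wpM2l ?leU.
have S2 : `|\sum_(K <= k < N) aN k| <= c' / 2 * (eps / (2 * c')) + (2 * c')^-1 * C.
  apply: (le_trans (ler_norm_sum _ _ _)).
  apply: (@le_trans _ _ (\sum_(K <= k < N) (c' / 2 * u k +
      (2 * c')^-1 * E2 (Dk X p (Linv_sum p N fs) k)))); first by apply: ler_sum => k _.
  rewrite big_split/= -!mulr_sumr lerD// ler_wpM2l//.
    apply: le_trans tailK; have := leU N.
    by rewrite /series/= (big_cat_nat (leq0n K) KN)/=; lra.
  apply: le_trans HC; rewrite (big_cat_nat (leq0n K) KN)/= lerDr.
  by apply: sumr_ge0 => k _; exact: E2_ge0.
have T1 : c / 2 * (E2 (rv X h) + U) <= eps / 4.
  apply: (@le_trans _ _ (c / 2 * B)); last first.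
    by rewrite /c le_eqVlt; apply/orP; left; apply/eqP; field; rewrite gt_eqF.
  by rewrite ler_wpM2l// lerDl.
have T2 : (2 * c)^-1 * (e' + e *+ K) <= eps / 8.
  apply: (@le_trans _ _ ((2 * c)^-1 * (eps * c / (4 * K.+1%:R) *+ K.+1))).
    rewrite ler_wpM2l// mulrS lerD//.
    by rewrite lerMn2r He orbT.
  rewrite -[X in _ * X]mulr_natl; have : 0 < K.+1%:R :> R by [].
  move: (K.+1%:R) => r r0; rewrite le_eqVlt; apply/orP; left; apply/eqP; field.
  by rewrite !gt_eqF.
have T3 : (2 * c')^-1 * C <= eps / 4.
  apply: (@le_trans _ _ ((2 * c')^-1 * (C + 1))).
    by rewrite ler_wpM2l// lerDl.
  rewrite /c' le_eqVlt; apply/orP; left; apply/eqP; field.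
  by rewrite !gt_eqF// ltr_wpDl.
have T4 : c' / 2 * (eps / (2 * c')) = eps / 4.
  by field; rewrite gt_eqF.
move: S1 S2 I3; rewrite E1 (big_cat_nat (leq0n K) KN)/= !ler_norml T4.
move=> /andP[S1l S1r] /andP[S2l S2r] /andP[I3l I3r].
move: T1 T2; rewrite !mulrDr => T1 T2.
by apply/andP; split; lra.
Unshelve. all: by end_near. Qed.

End Linv.
End limit.

(** * The remainder in the chain rule *)

Section key.
Context {R : realType} {d : measure_display} {T : measurableType d}.
Context (P : probability T R) (X : nat -> T -> R) (p : nat -> R).
Hypothesis HX : rademacher_family P X p.
Variables (f G : (nat -> R) -> R) (du : T -> R).
Hypothesis HF : D12 P X p f.
Hypothesis Hmean : (\int[P]_x (rv X f x)%:E = 0)%E.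
Hypothesis HG : is_Linv P X p f G.
Let u k w := (Num.sqrt (p k * q_ p k))^-1 * Dk X p f k w * `|Dk X p G k w|.
Hypothesis Hdu : is_delta P X p u du.

Lemma sign_ae : {ae P, forall x, forall k, X k x = 1 \/ X k x = -1}.
Proof.
apply/ae_foralln => k.
pose E := ~` (X k @^-1` [set 1] `|` X k @^-1` [set -1]).
have mE : measurable E.
  by apply: measurableC; apply: measurableU; apply: (measurable_X_set HX).
exists E; split => //.
  rewrite [LHS](probability_sign_split HX k mE).
  rewrite (_ : E `&` X k @^-1` [set 1] = set0); last first.
    by rewrite -subset0 => x [+ x1]; apply; left.
  rewrite (_ : E `&` X k @^-1` [set -1] = set0); last first.
    by rewrite -subset0 => x [+ x1]; apply; right.
  by rewrite measure0 adde0.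
Qed.

Lemma ae_le_Rintegral (a b : T -> R) : P.-integrable setT (EFin \o a) ->
  P.-integrable setT (EFin \o b) -> {ae P, forall x, a x <= b x} ->
  \int[P]_x a x <= \int[P]_x b x.
Proof.
move=> ia ib ab.
rewrite -subr_ge0 -RintegralB//.
have iD := integrableB measurableT ib ia.
rewrite /Rintegral (ae_eq_integral (fun x => (Num.max (b x - a x) 0)%:E))//.
- by apply: fine_ge0; apply: integral_ge0 => x _; rewrite lee_fin le_max lexx orbT.
- exact: measurable_int iD.
- apply/measurable_EFinP; apply: measurable_funrpos.
  by apply/measurable_EFinP; exact: measurable_int iD.
- apply: filterS ab => x abx _ /=.
  by rewrite /Num.max; case: ifP => //; rewrite ltNge subr_ge0 abx.
Qed.

Lemma lipschitz_D12 (phi : R -> R) K : measurable_fun setT phi ->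
  (forall a b, `|phi b - phi a| <= K * `|b - a|) ->
  D12 P X p (fun v => phi (f v)).
Proof.
move=> mphi lip; have [mf Lf fin] := HF.
have sqr_le (a b c : R) : `|a| <= b * `|c| -> a ^+ 2 <= b ^+ 2 * c ^+ 2.
  move=> abc; rewrite -[a ^+ 2]real_normK ?num_real// -[c ^+ 2]real_normK ?num_real//.
  rewrite -exprMn ler_sqr ?nnegrE//; exact: le_trans abc.
have mpf : gmeasurable (fun v => phi (f v)).
  by apply/gmeasurableP; apply: (measurableT_comp mphi); exact/gmeasurableP.
split => //.
  have mX := gmeasurable_Xvec HX mpf.
  have LD : L2 P (fun x => phi (rv X f x) - phi 0).
    have := L2_integrable_sqr (L2Z K Lf) => iL.
    apply: L2_intro; first by apply: measurable_funB => //; exact: mX.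
    apply: le_integrable iL => //.
      by apply/measurable_EFinP; apply: measurable_funX; apply: measurable_funB => //; exact: mX.
    move=> x _; rewrite !abse_EFin lee_fin !ger0_norm ?sqr_ge0// exprMn.
    by apply: sqr_le; have := lip 0 (rv X f x); rewrite subr0.
  rewrite (_ : rv _ _ = fun x => (phi (rv X f x) - phi 0) + cst (phi 0) x).
    by apply: L2D => //; exact: L2_cst.
  by apply/funext => x; rewrite /cst subrK.
have m1 : measurable_fun setT (fun x => \sum_(0 <= k <oo) ((Dk X p f k x) ^+ 2)%:E)%E.
  by apply: measurable_nneseries_sqr => k; exact: (measurable_Dk HX).
apply: (@le_lt_trans _ _ (\int[P]_x ((K ^+ 2)%:E *
    (\sum_(0 <= k <oo) ((Dk X p f k x) ^+ 2)%:E))%E)%E); last first.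
  rewrite ge0_integralZl_EFin ?sqr_ge0//; last first.
    by move=> x _; apply: nneseries_ge0 => k _ _; rewrite lee_fin sqr_ge0.
  by apply: lte_mul_pinfty => //; rewrite lee_fin sqr_ge0.
apply: ge0_le_integral => //.
- by move=> x _; apply: nneseries_ge0 => k _ _; rewrite lee_fin sqr_ge0.
- by apply: measurable_nneseries_sqr => k; exact: (measurable_Dk HX).
- exact: measurable_funeM.
move=> x _; rewrite -nneseriesZl//; last by move=> k _; rewrite lee_fin sqr_ge0.
apply: lee_nneseries => k _; first by rewrite lee_fin sqr_ge0.
rewrite -EFinM lee_fin /Dk; apply: sqr_le; rewrite !normrM mulrCA.
by rewrite ler_wpM2l.
Qed.

Lemma l2_finite_Dk g : D12 P X p g -> l2_finite (P := P) (Dk X p g).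
Proof. by move=> [mg _ fg]; split => // k; exact: (measurable_Dk HX). Qed.

Let I := inner (Dk X p f) (fun k w => - Dk X p G k w).

Lemma l2_finite_opp (a : nat -> T -> R) : l2_finite (P := P) a ->
  l2_finite (P := P) (fun k w => - a k w).
Proof.
move=> [ma ia]; split; first by move=> k; exact: measurable_funN.
move: ia; congr (_ < _)%E; apply: eq_integral => x _.
by apply: eq_eseriesr => k _; rewrite sqrrN.
Qed.

Let lG : l2_finite (P := P) (fun k w => - Dk X p G k w).
Proof.
by apply: l2_finite_opp; have [mf Lf _] := HF; exact: (Linv_l2_finite HX mf Lf Hmean HG).
Qed.

Lemma integrable_inner_Linv : P.-integrable setT (EFin \o I).
Proof. by have [_] := inner_spec (l2_finite_Dk HF) lG. Qed.

Lemma ibp h : D12 P X p h ->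
  \int[P]_x (rv X f x * rv X h x) =
  \int[P]_x (inner (Dk X p h) (fun k w => - Dk X p G k w) x).
Proof.
move=> Hh; have [mf Lf _] := HF.
have [_ _ c1] := inner_spec (l2_finite_Dk Hh) lG.
have c2 := Linv_ibp HX mf Lf Hmean HG Hh.
exact: (cvg_unique _ c2 c1).
Qed.

Lemma duality g : D12 P X p g ->
  \int[P]_x (inner (Dk X p g) u x) = \int[P]_x (rv X g x * du x).
Proof. by move=> Hg; case: Hdu => _ _ _ /(_ g Hg) /(congr1 fine). Qed.

(** Since [X k] is 1 or -1, [F] is one of its two resampled values, hence an endpoint in the sense
    of the remainder hypothesis. Exchanging the two values preserves both sides, which settles the
    case where they come in decreasing order. The inverse square root in [u] cancels the surplus one
    among three operators [D_k]. *)
Lemma Dk_rem (phi phi' g : R -> R) x k : X k x = 1 \/ X k x = -1 ->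
  (forall a b y, a <= b -> y = a \/ y = b ->
    `|phi b - phi a - phi' y * (b - a)| <= (b - a) * (g b - g a)) ->
  `|Dk X p (fun v => phi (f v)) k x * - Dk X p G k x
    - phi' (rv X f x) * (Dk X p f k x * - Dk X p G k x)| <=
  Dk X p (fun v => g (f v)) k x * u k x.
Proof.
move=> Xk rem.
have s0 : 0 < Num.sqrt (p k * q_ p k).
  by rewrite sqrtr_gt0 mulr_gt0 ?(p_gt0 HX) ?(q_gt0 HX).
rewrite /u /Dk; set s := Num.sqrt _ in s0 *.
set fp := f (upd _ k 1); set fm := f (upd _ k (-1)).
have fE : rv X f x = fp \/ rv X f x = fm.
  case: Xk => Xk; [left|right]; congr f; apply/funext => j; rewrite /upd.
    by case: eqP => // ->.
  by case: eqP => // ->.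
have H : `|phi fp - phi fm - phi' (rv X f x) * (fp - fm)| <= (fp - fm) * (g fp - g fm).
  have [le|/ltW le] := leP fm fp.
    by apply: rem => //; case: fE; [right|left].
  have := rem fp fm (rv X f x) le fE; rewrite -normrN => H.
  rewrite (_ : (fp - fm) * (g fp - g fm) = (fm - fp) * (g fm - g fp)); last by ring.
  apply: le_trans H; rewrite le_eqVlt; apply/orP; left.
  by apply/eqP; congr `|_|; ring.
set D := G _ - G _.
rewrite (_ : _ - _ = - (s * D) * (s * (phi fp - phi fm - phi' (rv X f x) * (fp - fm)))); last by ring.
rewrite (_ : s * (g fp - g fm) * _ = `|s * D| * (s * ((fp - fm) * (g fp - g fm)))); last first.
  by field; rewrite gt_eqF.
rewrite normrM normrN ler_wpM2l// normrM (gtr0_norm s0) ler_wpM2l//.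
exact: ltW.
Qed.

(** Abstract in [phi], [phi'], [g] because it serves twice: with [fz], [fz'], [hz] for the tail, and
    with [explin], [explin'], [explin'] for exponential moments. The estimate of [Dk_rem] is summed
    over partial sums and passed to the limit; duality evaluates the resulting bound. *)
Lemma stein_remainder (phi phi' g : R -> R) M :
  D12 P X p (fun v => phi (f v)) -> D12 P X p (fun v => g (f v)) ->
  measurable_fun setT phi' -> (forall w, `|phi' w| <= M) ->
  (forall a b y, a <= b -> y = a \/ y = b ->
    `|phi b - phi a - phi' y * (b - a)| <= (b - a) * (g b - g a)) ->
  P.-integrable setT (EFin \o (fun x => phi' (rv X f x) * I x)) /\
  `| \int[P]_x (rv X f x * phi (rv X f x)) - \int[P]_x (phi' (rv X f x) * I x)|
  <= \int[P]_x (g (rv X f x) * du x).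
Proof.
move=> Hphi Hg mphi' bphi' rem; have [mf Lf _] := HF.
have [aI iI _] := inner_spec (l2_finite_Dk HF) lG.
have [aphi iphi _] := inner_spec (l2_finite_Dk Hphi) lG.
have lu : l2_finite (P := P) u by case: Hdu.
have [ag ig _] := inner_spec (l2_finite_Dk Hg) lu.
have mX := gmeasurable_Xvec HX mf.
have i' : P.-integrable setT (EFin \o (fun x => phi' (rv X f x) * I x)).
  have := integrableZl measurableT M (integrable_norm iI).
  apply: le_integrable => //.
    apply/measurable_EFinP; apply: measurable_funM; first exact: measurableT_comp.
    by apply/measurable_EFinP; exact: measurable_int iI.
  move=> x _ /=; rewrite lee_fin normrM normrM normr_id.
  by rewrite ler_wpM2r// (le_trans (bphi' _))// ler_norm.
split => //.
have E1 := ibp Hphi; have E2 := duality Hg.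
rewrite [X in `|X - _|](_ : _ = \int[P]_x (inner (Dk X p (fun v => phi (f v)))
  (fun k w => - Dk X p G k w) x)); last exact: E1.
rewrite -[leRHS]E2 -RintegralB//.
have iB : P.-integrable setT (EFin \o (fun x => inner (Dk X p (fun v => phi (f v)))
    (fun k w => - Dk X p G k w) x - phi' (rv X f x) * I x)).
  exact: (integrableB measurableT iphi i').
apply: (le_trans (le_normr_Rintegral measurableT iB)).
apply: ae_le_Rintegral => //; first exact: integrable_norm iB.
apply: filterS3 sign_ae (filterI aI aphi) ag => x Xx [cI cphi] cg.
have cv1 : (fun n => `|\sum_(0 <= k < n) (Dk X p (fun v => phi (f v)) k x * - Dk X p G k x)
      - phi' (rv X f x) * \sum_(0 <= k < n) (Dk X p f k x * - Dk X p G k x)|) @ \oo -->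
    `|inner (Dk X p (fun v => phi (f v))) (fun k w => - Dk X p G k w) x
      - phi' (rv X f x) * I x|.
  by apply: cvg_norm; apply: cvgB => //; exact: cvgMr.
apply: (ler_cvg_to cv1 cg); apply: nearW => n.
rewrite mulr_sumr -sumrB; apply: (le_trans (ler_norm_sum _ _ _)).
by apply: ler_sum => k _; exact: Dk_rem.
Qed.

End key.

(** * Linearised exponentials and the Gronwall inequality *)

Section exp_lin.
Context {R : realType}.
Variables (t b : R).
Hypothesis t0 : 0 <= t.
Implicit Types (w a c y : R).

(* [exp (t w)] continued linearly beyond [b] *)
Definition explin w := expR (t * Num.min w b) * (1 + t * (w - Num.min w b)).
Definition explin' w := t * expR (t * Num.min w b).

Lemma explin_le w : w <= b -> explin w = expR (t * w).
Proof. by move=> wb; rewrite /explin min_l// subrr mulr0 addr0 mulr1. Qed.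

Let exp_tangent a c : expR (t * a) * (1 + t * (c - a)) <= expR (t * c).
Proof.
rewrite (_ : t * c = t * a + t * (c - a)); last by ring.
by rewrite expRD ler_wpM2l ?expR_ge0// expR_ge1Dx.
Qed.

(** Convexity; the tangents at both ends of an interval yield the remainder and Lipschitz estimates
    on [explin]. *)
Lemma explin_tangent a c : explin a + explin' a * (c - a) <= explin c.
Proof.
rewrite /explin /explin'.
set ma := Num.min a b; set mc := Num.min c b.
have Ea := expR_ge0 (t * ma); have Ec := expR_ge0 (t * mc).
rewrite (_ : _ + _ = expR (t * ma) * (1 + t * (c - ma))); last by ring.
have T := exp_tangent ma mc.
have mcc : 0 <= c - mc by rewrite subr_ge0 ge_min lexx.
rewrite (_ : 1 + t * (c - ma) = (1 + t * (mc - ma)) + t * (c - mc)); last by ring.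
rewrite !mulrDr mulr1.
have : expR (t * ma) * (t * (c - mc)) <= expR (t * mc) * (t * (c - mc)).
  have [cb|bc] := leP c b; first by rewrite /mc min_l// subrr !mulr0.
  rewrite ler_wpM2r ?mulr_ge0// ler_expR ler_wpM2l// /mc (min_r (ltW bc)).
  by rewrite /ma ge_min lexx orbT.
lra.
Qed.

Lemma explin'_ge0 w : 0 <= explin' w.
Proof. by rewrite mulr_ge0// expR_ge0. Qed.

Lemma explin'_le w : explin' w <= t * expR (t * b).
Proof. by rewrite ler_wpM2l// ler_expR ler_wpM2l// ge_min lexx orbT. Qed.

Lemma explin'_exp w : explin' w <= t * expR (t * w).
Proof. by rewrite ler_wpM2l// ler_expR ler_wpM2l// ge_min lexx. Qed.

(** The increment is enclosed between [explin' a * (c - a)] and [explin' c * (c - a)], so the slope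
    is its own dominating function [g]. *)
Lemma explin_rem a c y : a <= c -> y = a \/ y = c ->
  `|explin c - explin a - explin' y * (c - a)| <= (c - a) * (explin' c - explin' a).
Proof.
move=> ac yE; have H1 := explin_tangent a c; have H2 := explin_tangent c a.
have ac0 : 0 <= c - a by rewrite subr_ge0.
by rewrite ler_norml; case: yE => ->; apply/andP; split; nra.
Qed.

Lemma explin_lip a c : `|explin c - explin a| <= t * expR (t * b) * `|c - a|.
Proof.
wlog ac : a c / a <= c.
  move=> H; have [/H//|/ltW/H] := leP a c.
  by rewrite distrC [X in _ <= _ * X -> _]distrC.
have ac0 : 0 <= c - a by rewrite subr_ge0.
rewrite (ger0_norm ac0).
have H1 := explin_tangent a c; have H2 := explin_tangent c a.
have H3 := explin'_ge0 a; have H4 := explin'_le c.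
rewrite ler_norml; apply/andP; split; nra.
Qed.

(** The slope acts as [g] in [stein_remainder], so its value at [F] must lie in [D12] too. *)
Lemma explin'_lip a c : `|explin' c - explin' a| <= t * (t * expR (t * b)) * `|c - a|.
Proof.
wlog ac : a c / a <= c.
  move=> H; have [/H//|/ltW/H] := leP a c.
  by rewrite distrC [X in _ <= _ * X -> _]distrC.
have ac0 : 0 <= c - a by rewrite subr_ge0.
rewrite (ger0_norm ac0) /explin' -mulrBr normrM (ger0_norm t0) -mulrA ler_wpM2l//.
set ma := Num.min a b; set mc := Num.min c b.
have mac : ma <= mc by rewrite /ma /mc le_min ge_min ac/= ge_min lexx orbT.
have mD : mc - ma <= c - a.
  by rewrite /ma /mc /Num.min; case: ifP => ?; case: ifP => ?; lra.
rewrite ger0_norm; last by rewrite subr_ge0 ler_expR ler_wpM2l.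
have T := exp_tangent mc ma.
apply: (@le_trans _ _ (expR (t * mc) * (t * (mc - ma)))).
  have := expR_ge0 (t * mc); lra.
rewrite mulrCA -mulrA ler_wpM2l//; apply: ler_pM; rewrite ?expR_ge0 ?subr_ge0//.
by rewrite ler_expR ler_wpM2l// /mc ge_min lexx orbT.
Qed.

Lemma measurable_min_b : measurable_fun setT (fun w => Num.min w b).
Proof. exact: measurable_minr. Qed.

Lemma measurable_explin' : measurable_fun setT explin'.
Proof.
apply: measurable_funM => //; apply: measurableT_comp => //.
by apply: measurable_funM => //; exact: measurable_min_b.
Qed.

Lemma measurable_explin : measurable_fun setT explin.
Proof.
apply: measurable_funM.
  apply: measurableT_comp => //.
  by apply: measurable_funM => //; exact: measurable_min_b.
apply: measurable_funD => //; apply: measurable_funM => //.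
by apply: measurable_funB => //; exact: measurable_min_b.
Qed.

End exp_lin.

(* the implicit Euler scheme with step [t / n], whose factors [1 / (1 - y)] are
   at most [exp (y / (1 - y))] *)
Lemma discrete_gronwall {R : realType} (m : R -> R) (a t : R) :
  0 <= a -> 0 <= t -> (forall s, 0 <= s <= t -> 0 <= m s) ->
  (forall r s, 0 <= r -> r <= s -> s <= t -> m s - m r <= (s - r) * (s * a * m s)) ->
  m t <= m 0 * expR (a * t ^+ 2 / 2).
Proof.
move=> a0 t0 m0 step.
have m00 : 0 <= m 0 by rewrite m0// lexx.
pose c := a * t ^+ 2; have c0 : 0 <= c by rewrite mulr_ge0// sqr_ge0.
have scheme n : c * harmonic n < 1 ->
    m t <= m 0 * expR (c / 2 * (1 + harmonic n) / (1 - c * harmonic n)).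
  set h := harmonic n => ch1.
  have h0 : 0 < h by rewrite invr_gt0.
  have hn : n.+1%:R * h = 1 by rewrite divff.
  have d0 : 0 < 1 - c * h by rewrite subr_gt0.
  have ch0 : 0 <= c * h by rewrite mulr_ge0// ltW.
  (* The exponent collects the first [j] values of [y], namely [c * h^2 * i] for [i = 1, ..., j],
     over the smallest of the denominators [1 - y], which is [1 - c * h]. *)
  have ind j : (j <= n.+1)%N -> m (t * (j%:R * h)) <=
      m 0 * expR (c / 2 * (j%:R * (j%:R + 1) * h ^+ 2) / (1 - c * h)).
    elim: j => [_|j IH jn]; first by rewrite !(mul0r, mulr0) expR0 mulr1.
    have {}IH := IH (ltnW jn).
    have jh : j.+1%:R * h <= 1 by rewrite -[leRHS]hn ler_wpM2r ?(ltW h0)// ler_nat.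
    have j0 : (0 : R) <= j%:R by [].
    rewrite -natr1 in jh *.
    have jh0 : 0 <= j%:R * h by rewrite mulr_ge0// ltW.
    pose y := c * h * ((j%:R + 1) * h).
    have y0 : 0 <= y by rewrite mulr_ge0// mulr_ge0 ?addr_ge0// ltW.
    have yh : y <= c * h by rewrite ler_piMr.
    have sle : m (t * ((j%:R + 1) * h)) * (1 - y) <= m (t * (j%:R * h)).
      have := step (t * (j%:R * h)) (t * ((j%:R + 1) * h)).
      rewrite mulr_ge0// => /(_ isT).
      rewrite ler_wpM2l ?ler_wpM2r ?(ltW h0) ?lerDl// => /(_ isT).
      rewrite ler_piMr// => /(_ isT).
      rewrite /y /c; set M := m _; set M' := m _; nra.
    have e1 : (1 - y)^-1 <= expR (y / (1 - c * h)).
      apply: le_trans (expR_ge1Dx _).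
      apply: (@le_trans _ _ (1 + y / (1 - y))).
        rewrite le_eqVlt; apply/orP; left; apply/eqP; field.
        by rewrite gt_eqF//; lra.
      rewrite lerD2l ler_wpM2l// lef_pV2 ?posrE//; lra.
    have y1 : 0 < 1 - y by lra.
    have -> : c / 2 * ((j%:R + 1) * (j%:R + 1 + 1) * h ^+ 2) / (1 - c * h) =
        c / 2 * (j%:R * (j%:R + 1) * h ^+ 2) / (1 - c * h) + y / (1 - c * h).
      by rewrite /y; field; rewrite gt_eqF.
    rewrite expRD mulrA.
    apply: (@le_trans _ _ (m (t * (j%:R * h)) * (1 - y)^-1)).
      by rewrite ler_pdivlMr.
    apply: ler_pM => //; last by rewrite invr_ge0 ltW.
    by apply: m0; rewrite mulr_ge0//= ler_piMr//; lra.
  have E : n.+1%:R * (n.+1%:R + 1) * h ^+ 2 = 1 + h.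
    by rewrite expr2 mulrACA mulrDl hn !mul1r.
  by have := ind n.+1 (leqnn _); rewrite E hn mulr1.
have cv : (fun n => m 0 * expR (c / 2 * (1 + harmonic n) / (1 - c * harmonic n)))
    @ \oo --> m 0 * expR (c / 2 * (1 + 0) / (1 - c * 0)).
  apply: cvgMr; apply: (cvg_comp _ expR); last exact: continuous_expR.
  apply: cvgM.
    by apply: cvgMr; apply: cvgD; [exact: cvg_cst|exact: cvg_harmonic].
  apply: cvgV; first by rewrite mulr0 subr0 oner_eq0.
  apply: cvgB; first exact: cvg_cst.
  by apply: cvgMr; exact: cvg_harmonic.
rewrite addr0 mulr1 mulr0 subr0 divr1 in cv.
apply: (cvgr_to_ge cv); near=> n; apply: scheme; near: n.
have : (fun n => c * harmonic n) @ \oo --> c * 0 by apply: cvgMr; exact: cvg_harmonic.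
by rewrite mulr0 => H; exact: (cvgr_lt 0 H _ ltr01).
Unshelve. all: by end_near. Qed.

(** * Exponential moments *)

Section moment.
Context {R : realType} {d : measure_display} {T : measurableType d}.
Context (P : probability T R) (X : nat -> T -> R) (p : nat -> R).
Hypothesis HX : rademacher_family P X p.
Variables (f G : (nat -> R) -> R) (du : T -> R).
Hypothesis HF : D12 P X p f.
Hypothesis Hmean : (\int[P]_x (rv X f x)%:E = 0)%E.
Hypothesis HG : is_Linv P X p f G.
Hypothesis Hdu : is_delta P X p
           (fun k w => (Num.sqrt (p k * q_ p k))^-1 * Dk X p f k w
                       * `|Dk X p G k w|) du.
Let F := rv X f.
Let I := inner (Dk X p f) (fun k w => - Dk X p G k w).
Variables (A : R) (gamma1 gamma2 : R -> R).
Hypothesis Hexp : forall t, 0 <= t <= A ->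
     (\int[P]_x (expR (t * F x))%:E < +oo)%E.
Hypothesis H1 : forall t, 0 <= t <= A ->
     (\int[P]_x (`|1 - I x| * expR (t * F x))%:E
      <= (gamma1 t)%:E * \int[P]_x (expR (t * F x))%:E)%E.
Hypothesis H2 : forall t, 0 <= t <= A ->
     (\int[P]_x (`|du x| * expR (t * F x))%:E
      <= (gamma2 t)%:E * \int[P]_x (expR (t * F x))%:E)%E.

Definition mgf t := \int[P]_x (expR (t * F x)).

Let mF : measurable_fun setT F.
Proof. by case: HF => mf _ _; exact: (gmeasurable_Xvec HX mf). Qed.

Let LF : L2 P F. Proof. by case: HF. Qed.

Lemma measurable_exp t : measurable_fun setT (fun x => expR (t * F x)).
Proof. by apply: measurableT_comp => //; exact: measurable_funM. Qed.

Lemma integrable_exp t : 0 <= t <= A ->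
  P.-integrable setT (EFin \o (fun x => expR (t * F x))).
Proof.
move=> tA; apply/integrableP; split; first exact/measurable_EFinP/measurable_exp.
by under eq_integral do rewrite /= ger0_norm ?expR_ge0//; exact: Hexp.
Qed.

Lemma mgfE t : 0 <= t <= A -> (\int[P]_x (expR (t * F x))%:E = (mgf t)%:E)%E.
Proof.
by move=> tA; rewrite /mgf /Rintegral fineK//; exact: integrable_fin_num (integrable_exp tA).
Qed.

Lemma mgf_ge0 t : 0 <= mgf t.
Proof. by apply: Rintegral_ge0 => x _; exact: expR_ge0. Qed.

Lemma mgf0 : mgf 0 = 1.
Proof.
rewrite /mgf (@eq_Rintegral _ _ _ P setT (cst 1)); last by move=> x _; rewrite mul0r expR0.
by rewrite Rintegral_cst// mul1r [X in fine X](@probability_setT _ _ _ P).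
Qed.

Lemma weighted_exp (V : T -> R) (gam : R) t : measurable_fun setT V ->
  (forall x, 0 <= V x) -> 0 <= t <= A ->
  (\int[P]_x (V x * expR (t * F x))%:E
      <= gam%:E * \int[P]_x (expR (t * F x))%:E)%E ->
  P.-integrable setT (EFin \o (fun x => V x * expR (t * F x))) /\
  \int[P]_x (V x * expR (t * F x)) <= gam * mgf t.
Proof.
move=> mV V0 tA; rewrite mgfE// => H.
have i : P.-integrable setT (EFin \o (fun x => V x * expR (t * F x))).
  apply/integrableP; split.
    by apply/measurable_EFinP; apply: measurable_funM => //; exact: measurable_exp.
  under eq_integral do rewrite /= ger0_norm ?mulr_ge0 ?expR_ge0//.
  by apply: le_lt_trans H _; rewrite -EFinM ltry.
split => //; rewrite -lee_fin EFinM /Rintegral fineK//.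
exact: integrable_fin_num.
Qed.

Let mI : measurable_fun setT I.
Proof.
by apply/measurable_EFinP; exact: measurable_int (integrable_inner_Linv HX HF Hmean HG).
Qed.

Lemma mgf_V1 t : 0 <= t <= A ->
  P.-integrable setT (EFin \o (fun x => `|1 - I x| * expR (t * F x))) /\
  \int[P]_x (`|1 - I x| * expR (t * F x)) <= gamma1 t * mgf t.
Proof.
move=> tA; apply: weighted_exp => //; last exact: H1.
by apply: measurableT_comp => //; exact: measurable_funB.
Qed.

Lemma mgf_V2 t : 0 <= t <= A ->
  P.-integrable setT (EFin \o (fun x => `|du x| * expR (t * F x))) /\
  \int[P]_x (`|du x| * expR (t * F x)) <= gamma2 t * mgf t.
Proof.
move=> tA; apply: weighted_exp => //; last exact: H2.
by apply: measurableT_comp => //; case: Hdu => _ _ [].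
Qed.

(** The slope is at most [t * expR (t * F)] whatever the level [b], which may therefore go to
    infinity. [I <= 1 + |1 - I|] brings the main term under the hypothesis on [gamma1]; the
    remainder falls under that on [gamma2]. *)
Lemma explin_bound t b : 0 <= t <= A ->
  P.-integrable setT (EFin \o (fun x => F x * explin t b (F x))) /\
  \int[P]_x (F x * explin t b (F x)) <= t * (1 + gamma1 t + gamma2 t) * mgf t.
Proof.
move=> tA; have /andP[t0 _] := tA.
have D1 := lipschitz_D12 HX HF (measurable_explin t b) (explin_lip b t0).
have D2 := lipschitz_D12 HX HF (measurable_explin' t b) (explin'_lip b t0).
have bnd w : `|explin' t b w| <= t * expR (t * b).
  by rewrite ger0_norm ?explin'_ge0// explin'_le.
have [iI rem] := stein_remainder HX HF Hmean HG Hdu D1 D2 (measurable_explin' t b) bnd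
  (explin_rem b t0).
split; first by apply: L2_integrable => //; case: D1.
have [i1 b1] := mgf_V1 tA; have [i2 b2] := mgf_V2 tA.
have ie := integrable_exp tA.
have j1 : P.-integrable setT (EFin \o (fun x => t * (expR (t * F x) + `|1 - I x| * expR (t * F x)))).
  exact: (integrableZl measurableT t (integrableD measurableT ie i1)).
have j2 : P.-integrable setT (EFin \o (fun x => t * (`|du x| * expR (t * F x)))).
  exact: (integrableZl measurableT t i2).
have ig : P.-integrable setT (EFin \o (fun x => explin' t b (F x) * du x)).
  by apply: L2_integrable; [case: D2|case: Hdu].
have B1 : \int[P]_x (explin' t b (F x) * I x) <= t * (mgf t + gamma1 t * mgf t).
  apply: (@le_trans _ _ (\int[P]_x (t * (expR (t * F x) + `|1 - I x| * expR (t * F x))))).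
    apply: le_Rintegral => // x _.
    have e0 := explin'_ge0 b t0 (F x); have e1 := explin'_exp b t0 (F x).
    have : I x <= 1 + `|1 - I x|.
      by have := ler_norm (- (1 - I x)); rewrite normrN; lra.
    have := normr_ge0 (1 - I x); move: `|_| => v v0 Iv.
    apply: (@le_trans _ _ (explin' t b (F x) * (1 + v))); first by rewrite ler_wpM2l.
    rewrite (_ : t * _ = t * expR (t * F x) * (1 + v)); last by ring.
    by rewrite ler_wpM2r// addr_ge0.
  rewrite RintegralZl//; last exact: (integrableD measurableT ie i1).
  by rewrite ler_wpM2l// RintegralD// lerD2l.
have B2 : \int[P]_x (explin' t b (F x) * du x) <= t * (gamma2 t * mgf t).
  apply: (@le_trans _ _ (\int[P]_x (t * (`|du x| * expR (t * F x))))).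
    apply: le_Rintegral => // x _.
    have e0 := explin'_ge0 b t0 (F x); have e1 := explin'_exp b t0 (F x).
    apply: (@le_trans _ _ (explin' t b (F x) * `|du x|)).
      by rewrite ler_wpM2l// ler_norm.
    by rewrite [`|_| * _]mulrC mulrA ler_wpM2r.
  by rewrite RintegralZl// ler_wpM2l.
move: rem; rewrite ler_norml => /andP[_ rem].
have := le_trans rem B2; rewrite -/I -/F; move: B1.
rewrite (_ : t * (1 + gamma1 t + gamma2 t) * mgf t =
  t * (mgf t + gamma1 t * mgf t) + t * (gamma2 t * mgf t)); last by ring.
lra.
Qed.

(** Convexity gives [exp(s F) - exp(r F) <= (s - r) F exp(s F)], so [mgf] is never differentiated.
    On [F <= n] the exponential agrees with its linear continuation, beyond [n] the bound is
    nonnegative, and [n] goes to infinity by dominated convergence. *)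
Lemma mgf_increment r s : 0 <= r -> r <= s -> s <= A ->
  mgf s - mgf r <= (s - r) * (s * (1 + gamma1 s + gamma2 s) * mgf s).
Proof.
move=> r0 rs sA.
have sI : 0 <= s <= A by rewrite (le_trans r0 rs).
have rI : 0 <= r <= A by rewrite r0 (le_trans rs sA).
have is_ := integrable_exp sI; have ir := integrable_exp rI.
have id_ := integrableB measurableT is_ ir.
pose D x := expR (s * F x) - expR (r * F x).
rewrite (_ : mgf s - mgf r = \int[P]_x D x); last by rewrite RintegralB.
pose D_ (n : nat) x := if F x <= n%:R then D x else 0.
have mD : measurable_fun setT D.
  by apply: measurable_funB; exact: measurable_exp.
have mD_ n : measurable_fun setT (D_ n).
  apply: measurable_fun_ifT => //; exact: measurable_fun_ler.
have [||||j1 _ j2] := @dominated_convergence _ _ _ P setT measurableT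
  (fun n x => (D_ n x)%:E) (EFin \o D) (fun x => `|(EFin \o D) x|)%E
  _ _ _ (integrable_abse id_).
- by move=> n; exact/measurable_EFinP.
- exact/measurable_EFinP.
- apply: aeW => x _; apply: cvg_EFin; first exact: nearW.
  apply: cvg_near_cst; near=> n.
  rewrite /D_ /= ifT//; near: n; exact: nbhs_infty_ger.
- apply: aeW => x n _; rewrite /D_ /=; case: ifP => // _.
  by rewrite normr0 lee_fin.
rewrite -lee_fin /Rintegral fineK; last exact: integrable_fin_num id_.
rewrite -(cvg_lim _ j2)//; apply: lime_le; first exact: cvgP j2.
apply: nearW => n /=.
have [iF bF] := explin_bound n%:R sI.
have iD_ : P.-integrable setT (EFin \o D_ n).
  apply: le_integrable id_ => //; first exact/measurable_EFinP.
  by move=> x _; rewrite /D_ /= lee_fin; case: ifP => // _; rewrite normr0.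
apply: (@le_trans _ _ (\int[P]_x ((s - r) * (F x * explin s n%:R (F x))))%:E).
  rewrite -[leLHS]fineK; last exact: integrable_fin_num iD_.
  rewrite lee_fin; apply: le_Rintegral => //.
    exact: (integrableZl measurableT (s - r) iF).
  move=> x _; rewrite /D_; case: ifPn => [Fn|].
    rewrite explin_le// /D.
    have := expR_ge1Dx ((r - s) * F x).
    have := expR_gt0 (s * F x).
    rewrite (_ : r * F x = s * F x + (r - s) * F x); last by ring.
    rewrite expRD; set e := expR _; set e' := expR _ => e0; nra.
  rewrite -ltNge => nF; have F0 : 0 <= F x by rewrite ltW// (le_lt_trans _ nF).
  have /andP[s0 _] := sI.
  rewrite mulr_ge0 ?subr_ge0// mulr_ge0// /explin mulr_ge0 ?expR_ge0//.
  by rewrite addr_ge0// mulr_ge0// subr_ge0 ge_min lexx.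
by rewrite lee_fin RintegralZl// ler_wpM2l// subr_ge0.
Unshelve. all: by end_near. Qed.

Hypothesis Hg1 : {homo gamma1 : s t / s <= t}.
Hypothesis Hg2 : {homo gamma2 : s t / s <= t}.

(** At [t = 0] the exponential moment is 1, so both gammas dominate expectations of nonnegative
    variables there; monotonicity carries this to [t]. *)
Lemma gamma_ge0 t : 0 <= t <= A -> 0 <= gamma1 t /\ 0 <= gamma2 t.
Proof.
move=> /andP[t0 tA]; have A0 : 0 <= (0:R) <= A by rewrite lexx (le_trans t0).
have [_ b1] := mgf_V1 A0; have [_ b2] := mgf_V2 A0.
rewrite mgf0 mulr1 in b1; rewrite mgf0 mulr1 in b2.
split; [apply: le_trans (Hg1 t0)|apply: le_trans (Hg2 t0)].
  by apply: le_trans b1; apply: Rintegral_ge0 => x _; rewrite mulr_ge0 ?expR_ge0.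
by apply: le_trans b2; apply: Rintegral_ge0 => x _; rewrite mulr_ge0 ?expR_ge0.
Qed.

(** On [[0, t]] the gammas are replaced by their values at [t], which makes the increment inequality
    that of [discrete_gronwall]. *)
Lemma mgf_le t : 0 <= t <= A ->
  mgf t <= expR ((1 + gamma1 t + gamma2 t) * t ^+ 2 / 2).
Proof.
move=> tA; have /andP[t0 tlA] := tA; have [g1 g2] := gamma_ge0 tA.
have a0 : 0 <= 1 + gamma1 t + gamma2 t by rewrite !addr_ge0.
have := @discrete_gronwall _ mgf _ _ a0 t0 (fun s _ => mgf_ge0 s).
rewrite mgf0 mul1r; apply.
move=> r s r0 rs st; apply: (le_trans (mgf_increment r0 rs (le_trans st tlA))).
have s0 := le_trans r0 rs.
rewrite ler_wpM2l ?subr_ge0// ler_wpM2r ?mgf_ge0// ler_wpM2l//.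
by rewrite lerD ?Hg2// lerD ?Hg1.
Qed.

End moment.

(** * Pointwise bounds by Gaussian-weighted exponentials *)

Section gauss_weights.
Context {R : realType}.
Implicit Types (w z : R) (r : seq (R * R)).

(** The pairs are (mass, parameter); each [exp(t w - t^2/2)] has mean 1 under the standard normal
    law. *)
Definition gweight r w := \sum_(q <- r) q.1 * expR (q.2 * w - q.2 ^+ 2 / 2).

(** Parameter 0 serves [w <= 0] and the constant term; an integer [j <= z] serves the cell
    [[j - 1, j]]. The mass at [z] has two parts: one for the last cell [[z - 1, z]], and one for the
    half-line beyond [z], twice the coefficient in [Phi_tail_lower]. *)
Definition weights z : seq (R * R) :=
  [:: (1, 0), (Num.sqrt (2 * pi) * expR 2^-1 * z +
      2 * (expR 1 * Num.sqrt (2 * pi) * (1 + z)), z) &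
    [seq (Num.sqrt (2 * pi) * expR 2^-1 * j%:R, j%:R) | j <- iota 1 (Num.truncn z)]].

Lemma gweight_ge0 r w : (forall q, q \in r -> 0 <= q.1) -> 0 <= gweight r w.
Proof.
move=> r0; rewrite /gweight big_seq; apply: sumr_ge0 => q /r0 q0.
by rewrite mulr_ge0// expR_ge0.
Qed.

Lemma gweight_mem r w q : (forall q, q \in r -> 0 <= q.1) -> q \in r ->
  q.1 * expR (q.2 * w - q.2 ^+ 2 / 2) <= gweight r w.
Proof.
move=> r0 qr; rewrite /gweight (perm_big _ (perm_to_rem qr))/= big_cons lerDl.
by apply: gweight_ge0 => q' /mem_rem /r0.
Qed.

Let s2_ge0 : 0 <= Num.sqrt (2 * pi) :> R. Proof. exact: sqrtr_ge0. Qed.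

Let tail_ge0 z : 0 <= z ->
  forall q, q \in [seq (Num.sqrt (2 * pi) * expR 2^-1 * j%:R, j%:R : R) | j <- iota 1 (Num.truncn z)] ->
  0 <= q.1 :> R.
Proof.
by move=> z0 q /mapP[j _ ->] /=; rewrite !mulr_ge0 ?expR_ge0.
Qed.

(* [w <= t] and [(t - w)^2 <= 1] give [w^2 / 2 <= t w - t^2 / 2 + 1 / 2] *)
Lemma gauss_cell w t : 0 <= w -> w <= t -> t - w <= 1 ->
  w * expR (w ^+ 2 / 2) <= expR 2^-1 * t * expR (t * w - t ^+ 2 / 2).
Proof.
move=> w0 wt tw; rewrite -mulrA mulrCA -expRD; apply: ler_pM; rewrite ?expR_ge0// ler_expR.
have : (t - w) ^+ 2 <= 1 by rewrite expr_le1// subr_ge0.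
by rewrite sqrrB; lra.
Qed.

Lemma weights_mid z w : 0 < w -> w <= z ->
  1 + Num.sqrt (2 * pi) * (w * expR (w ^+ 2 / 2)) <= gweight (weights z) w.
Proof.
move=> w0 wz; have z0 : 0 <= z by rewrite (le_trans (ltW w0)).
have L0 : 0 <= expR 1 * Num.sqrt (2 * pi) * (1 + z) by rewrite !mulr_ge0 ?expR_ge0 ?addr_ge0.
rewrite /gweight /weights !big_cons /= mul0r expr0n/= mul0r subr0 expR0 mulr1 lerD2l.
rewrite [(_ + _) * expR _]mulrDl; set B := 2 * (expR 1 * _ * _) * _.
have B0 : 0 <= B by rewrite mulr_ge0 ?expR_ge0// mulr_ge0.
set S := \sum_(_ <- _) _.
have S0 : 0 <= S by exact: gweight_ge0 (tail_ge0 z0).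
have [cz|zc] := leP (z - w) 1.
  have := gauss_cell (ltW w0) wz cz.
  move=> /(ler_wpM2l s2_ge0); rewrite !mulrA => H.
  by rewrite -addrA; apply: le_trans H _; rewrite lerDl addr_ge0.
(* The integer above [w] is at most [z], as [z - w > 1]. *)
pose j := (Num.truncn w).+1.
have wj : w <= j%:R by rewrite ltW// truncnS_gt.
have jw : j%:R - w <= 1.
  have := truncn_le w; rewrite (ltW w0) /j -natr1; lra.
have jz : j \in iota 1 (Num.truncn z).
  by rewrite mem_iota /= add1n ltnS truncn_ge_nat//; lra.
have := gauss_cell (ltW w0) wj jw => /(ler_wpM2l s2_ge0); rewrite !mulrA => H.
apply: (le_trans H).
have := @gweight_mem _ w (Num.sqrt (2 * pi) * expR 2^-1 * j%:R, j%:R) (tail_ge0 z0) _.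
rewrite map_f// => /(_ isT) /= H2; apply: (le_trans H2).
rewrite -[leLHS]/S lerDr addr_ge0//.
by rewrite !mulr_ge0 ?expR_ge0.
Qed.

Lemma weights_bound z w : 0 <= z ->
  `|fz' z w| <= (1 - Phi z) * gweight (weights z) w /\
  `|hz z w| <= (1 - Phi z) * gweight (weights z) w.
Proof.
move=> z0; have c0 : 0 < 1 - Phi z :> R by rewrite subr_gt0 Phi_lt1.
have w0 q : q \in weights z -> 0 <= q.1.
  rewrite !inE => /or3P[/eqP->//|/eqP->/=|/(tail_ge0 z0)//].
  by rewrite addr_ge0// ?mulr_ge0 ?expR_ge0 ?addr_ge0.
have g1 : 1 <= gweight (weights z) w.
  have := gweight_mem w w0 (mem_head _ _); rewrite /= mul0r expr0n/= mul0r subr0.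
  by rewrite expR0 mulr1.
have [wn|wp] := leP w 0.
  have [H1 H2] := fz'_bound_neg z0 wn.
  by split; [apply: le_trans H1 _|apply: le_trans H2 _]; rewrite ler_peMr// ltW.
have [wz|zw] := leP w z.
  have [H1 H2] := fz'_bound_mid wp wz; have H := weights_mid wp wz.
  by split; [apply: le_trans H1 _|apply: le_trans H2 _]; rewrite ler_wpM2l// ltW.
(* Beyond [z] the two functions are bounded by 1 and 2 only. There the exponential with parameter
   [z] is at least [exp(z^2/2)], and [Phi_tail_lower] converts this into the factor [1 - Phi z]. *)
suff H : 2 <= (1 - Phi z) * gweight (weights z) w.
  split; last exact: le_trans (hz_le2 _ _) H.
  by apply: le_trans (norm_fz'_le1 _ _) (le_trans _ H); lra.
have T := Phi_tail_lower z0.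
set L := expR 1 * _ * _ in T.
pose q : R * R := (Num.sqrt (2 * pi) * expR 2^-1 * z + 2 * L, z).
have qw : q \in weights z by rewrite !inE eqxx orbT.
apply: le_trans (ler_wpM2l (ltW c0) (gweight_mem w w0 qw)) => /=.
have e1 : expR (z ^+ 2 / 2) <= expR (z * w - z ^+ 2 / 2).
  rewrite ler_expR; nra.
have L0 : 0 <= L by rewrite !mulr_ge0 ?expR_ge0 ?addr_ge0.
apply: (@le_trans _ _ ((1 - Phi z) * ((2 * L) * expR (z ^+ 2 / 2)))); last first.
  apply: ler_wpM2l; first exact: ltW.
  apply: ler_pM; [by rewrite mulr_ge0|exact: expR_ge0| |exact: e1].
  by rewrite lerDr !mulr_ge0 ?expR_ge0.
have -> : (1 - Phi z) * ((2 * L) * expR (z ^+ 2 / 2)) = 2 * ((L * (1 - Phi z)) * expR (z ^+ 2 / 2)) by ring.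
rewrite -[leLHS]mulr1 ler_wpM2l//.
by rewrite -ler_pdivrMr ?expR_gt0// mul1r -expRN.
Qed.

(** [exp(- 1/6) >= 5/6], cubed and inverted: [(6/5)^3 = 216/125]. *)
Lemma expR_half_le : expR 2^-1 <= 216 / 125 :> R.
Proof.
have h : 5 / 6 <= expR (- (1 / 6)) :> R.
  by have := expR_ge1Dx (- (1 / 6) : R); lra.
have : (5 / 6) ^+ 3 <= expR (- 2^-1) :> R.
  rewrite (_ : - 2^-1 = - (1 / 6) * 3%:R); last by field.
  by rewrite expRM_natr lerXn2r// nnegrE// ?expR_ge0; lra.
rewrite expRN; have := expR_gt0 (2^-1 : R); move: (expR _) => e e0 H.
have := ler_wpM2l (ltW e0) H; rewrite divff ?gt_eqF// !exprS expr0; lra.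
Qed.

(** From [pi < 4], as [sqrt 8 < 2.83]. *)
Lemma sqrt_2pi_le : Num.sqrt (2 * pi) <= 283 / 100 :> R.
Proof.
rewrite -[leRHS]ger0_norm; last lra.
rewrite -sqrtr_sqr ler_sqrt; last exact: sqr_ge0.
have := @pihalf_lt2 R; lra.
Qed.

(** With [sqrt(2 pi) exp(1/2) <= 4.9] and [e sqrt(2 pi) <= 8.46] the total is at most
    [17.92 + 24.27 z + 2.45 z^2], a quadratic that stays below [25 (1 + z^2)]. *)
Lemma sum_weights_le z : 0 <= z -> \sum_(q <- weights z) q.1 <= 25 * (1 + z ^+ 2).
Proof.
move=> z0; rewrite /weights !big_cons big_map /= -mulr_sumr.
have Sj : \sum_(j <- iota 1 (Num.truncn z)) j%:R <= (z ^+ 2 + z) / 2 :> R.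
  have : 2 * \sum_(j <- iota 1 (Num.truncn z)) j%:R = (Num.truncn z)%:R ^+ 2 + (Num.truncn z)%:R :> R.
    elim: (Num.truncn z) => [|n IH]; first by rewrite big_nil; ring.
    by rewrite -[n.+1]addn1 iotaD big_cat /= big_seq1 mulrDr IH add1n !natrD -natr1; ring.
  have := truncn_le z; rewrite z0 => ?; have : 0 <= (Num.truncn z)%:R :> R by [].
  by move: (\sum_(_ <- _) _) => S; nra.
move: Sj; set S := \sum_(_ <- _) _ => Sj.
have S0 : 0 <= S by apply: sumr_ge0.
have e1 : expR 1 = expR 2^-1 * expR 2^-1 :> R.
  by rewrite -expRD; congr expR; field.
have := sqrt_2pi_le; have := expR_half_le; have := expR_ge0 (2^-1 : R); have := s2_ge0.
rewrite e1; move: (expR _) (Num.sqrt _) => e s s0 e0 el sl.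
have se : s * e <= 49 / 10 by nra.
have see : e * e * s <= 423 / 50 by nra.
have A1 : s * e * z + s * e * S <= 49 / 10 * (z + (z ^+ 2 + z) / 2).
  by rewrite -mulrDr; apply: ler_pM => //; rewrite ?mulr_ge0 ?addr_ge0// lerD2l.
have A2 : 2 * (e * e * s * (1 + z)) <= 2 * (423 / 50 * (1 + z)).
  by rewrite ler_wpM2l// ler_wpM2r// addr_ge0.
have := sqr_ge0 (z - 1 / 2); nra.
Qed.

End gauss_weights.

(** * Integration of the exponential weights *)

Section weighted.
Context {R : realType} {d : measure_display} {T : measurableType d}.
Context (P : probability T R) (F V : T -> R) (z B : R).
Hypothesis HV : forall t, 0 <= t <= z ->
  P.-integrable setT (EFin \o (fun x => V x * expR (t * F x))) /\
  \int[P]_x (V x * expR (t * F x)) <= B * expR (t ^+ 2 / 2).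

(** The factor [exp(- t^2/2)] of a weight cancels the [exp(t^2/2)] of the assumed bound, so that
    only the masses remain. *)
Lemma weighted_gweight (r : seq (R * R)) :
  (forall q, q \in r -> 0 <= q.1 /\ 0 <= q.2 <= z) ->
  P.-integrable setT (EFin \o (fun x => V x * gweight r (F x))) /\
  \int[P]_x (V x * gweight r (F x)) <= B * \sum_(q <- r) q.1.
Proof.
elim: r => [_|q r IH rz].
  rewrite (_ : (fun x => _) = cst 0); last by apply/funext => x; rewrite /gweight big_nil mulr0.
  by split; [exact: L2_integrable1 (L2_cst 0)|rewrite big_nil mulr0 Rintegral_cst// mul0r].
have [i1 b1] : P.-integrable setT (EFin \o (fun x => V x * gweight r (F x))) /\
  \int[P]_x (V x * gweight r (F x)) <= B * \sum_(q <- r) q.1.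
  by apply: IH => q' q'r; apply: rz; rewrite inE q'r orbT.
have [q0 qz] := rz q (mem_head _ _).
have [i2 b2] := HV qz.
pose c := q.1 * expR (- (q.2 ^+ 2 / 2)).
have c0 : 0 <= c by rewrite mulr_ge0// expR_ge0.
have i3 := integrableZl measurableT c i2.
rewrite (_ : (fun x => _) = fun x => c * (V x * expR (q.2 * F x)) + V x * gweight r (F x)); last first.
  by apply/funext => x; rewrite /gweight big_cons /c expRD; ring.
split; first exact: (integrableD measurableT i3 i1).
rewrite RintegralD// RintegralZl// big_cons mulrDr lerD//.
apply: (le_trans (ler_wpM2l c0 b2)).
rewrite /c expRN le_eqVlt; apply/orP; left; apply/eqP; field.
by rewrite gt_eqF ?expR_gt0.
Qed.

End weighted.

Section measurability.
Context {R : realType}.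

Lemma measurable_fz (z : R) : measurable_fun setT (fz z).
Proof.
apply: continuous_measurable_fun => x; apply/cvgrPdist_le => e e0.
near=> y; apply: (le_trans (fz_lip z y x)).
by near: y; apply: cvgr_dist_le.
Unshelve. all: by end_near. Qed.

Lemma measurable_fz' (z : R) : measurable_fun setT (fz' z).
Proof.
apply: measurable_funB.
  apply: measurable_funD => //; apply: measurable_funM => //; exact: measurable_fz.
by apply: measurable_fun_ifT => //; exact: measurable_fun_ltr.
Qed.

End measurability.

(** * The relative error of the Gaussian tail *)

Unset Implicit Arguments.

Theorem theorem3p2 (R : realType) (d : measure_display) (T : measurableType d)
  (P : probability T R) (X : nat -> T -> R) (p : nat -> R)
  (HX : rademacher_family P X p)
  (f : (nat -> R) -> R)
  (HF : D12 P X p f)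
  (Hmean : (\int[P]_x (rv X f x)%:E = 0)%E)
  (Hvar : (\int[P]_x ((rv X f x) ^+ 2)%:E = 1)%E)
  (Hfz : forall z : R,
     D12 P X p (fun v => f v * fz z (f v) + (if z < f v then 1 else 0)))
  (G : (nat -> R) -> R) (HG : is_Linv P X p f G)
  (du : T -> R)
  (Hdu : is_delta P X p
           (fun k w => (Num.sqrt (p k * q_ p k))^-1 * Dk X p f k w
                       * `|Dk X p G k w|) du)
  (A : R) (HA : 0 < A) (gamma1 gamma2 : R -> R)
  (Hg1 : {homo gamma1 : s t / s <= t}) (Hg2 : {homo gamma2 : s t / s <= t})
  (Hexp : forall t, 0 <= t <= A ->
     (\int[P]_x (expR (t * rv X f x))%:E < +oo)%E)
  (H1 : forall t, 0 <= t <= A ->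
     (\int[P]_x (`|1 - inner (Dk X p f) (fun k w => - Dk X p G k w) x|
                 * expR (t * rv X f x))%:E
      <= (gamma1 t)%:E * \int[P]_x (expR (t * rv X f x))%:E)%E)
  (H2 : forall t, 0 <= t <= A ->
     (\int[P]_x (`|du x| * expR (t * rv X f x))%:E
      <= (gamma2 t)%:E * \int[P]_x (expR (t * rv X f x))%:E)%E) :
  forall z : R, 0 <= z <= A ->
    `| fine (P [set x | z < rv X f x]) / (1 - Phi z) - 1 |
    <= 25 * expR (z ^+ 2 / 2 * (gamma1 z + gamma2 z)) * (1 + z ^+ 2)
       * (gamma1 z + gamma2 z).
Proof.
move=> z /andP[z0 zA].
set F := rv X f in Hexp H1 H2 *; set I := inner _ _ in H1.
have [mf LF _] := HF; have mF := gmeasurable_Xvec HX mf.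
have zIA : 0 <= z <= A by rewrite z0.
have c0 : 0 < 1 - Phi z :> R by rewrite subr_gt0 Phi_lt1.
set c := 1 - Phi z in c0 *.
have D1 : D12 P X p (fun v => fz z (f v)).
  by apply: (lipschitz_D12 HX HF (measurable_fz z) (K := 1)) => a b; rewrite mul1r fz_lip.
have [iI rem] := stein_remainder HX HF Hmean HG Hdu D1 (Hfz z) (measurable_fz' z)
  (norm_fz'_le1 z) (@fz_rem R z).
have [g10 g20] := gamma_ge0 HX HF Hmean HG Hdu Hexp H1 H2 Hg1 Hg2 zIA.
(* [mgf_le] bounds [E[exp(t F - t^2/2)]] by [exp(t^2/2 (gamma1 t + gamma2 t))], whose exponent is
   largest at [t = z]; hence one [M] serves all weights. *)
pose M := expR (z ^+ 2 / 2 * (gamma1 z + gamma2 z)).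
have mgfM t : 0 <= t <= z -> mgf P X f t <= M * expR (t ^+ 2 / 2).
  move=> /andP[t0 tz]; have tA : 0 <= t <= A by rewrite t0 (le_trans tz).
  have := mgf_le HX HF Hmean HG Hdu Hexp H1 H2 Hg1 Hg2 tA.
  move=> /le_trans; apply; rewrite -expRD ler_expR.
  have G1 := Hg1 _ _ tz; have G2 := Hg2 _ _ tz.
  have t2 : t ^+ 2 <= z ^+ 2 by rewrite ler_sqr ?nnegrE.
  have : t ^+ 2 * (gamma1 t + gamma2 t) <= z ^+ 2 * (gamma1 z + gamma2 z).
    apply: (@le_trans _ _ (t ^+ 2 * (gamma1 z + gamma2 z))).
      by rewrite ler_wpM2l ?sqr_ge0// lerD.
    by rewrite ler_wpM2r// addr_ge0.
  lra.
(* Common to both error terms: [V] is [|1 - I|] with [gamma1], or [|du|] with [gamma2]. *)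
have hyp (V : T -> R) (gam : R -> R) : {homo gam : s t / s <= t} -> 0 <= gam z ->
   (forall t, 0 <= t <= A ->
     P.-integrable setT (EFin \o (fun x => V x * expR (t * F x))) /\
     \int[P]_x (V x * expR (t * F x)) <= gam t * mgf P X f t) ->
   P.-integrable setT (EFin \o (fun x => V x * gweight (weights z) (F x))) /\
   \int[P]_x (V x * gweight (weights z) (F x)) <= (gam z * M) * (25 * (1 + z ^+ 2)).
  move=> gamh gamz HV.
  have [||i b] := @weighted_gweight _ _ _ P F V z (gam z * M) _ (weights z).
  - move=> t tz; have /andP[t0 tlz] := tz.
    have [|i b] := HV t; first by rewrite t0 (le_trans tlz).
    split => //; apply: le_trans b _; rewrite -mulrA.
    apply: (@le_trans _ _ (gam z * mgf P X f t)).
      by rewrite ler_wpM2r ?mgf_ge0 ?gamh.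
    by rewrite ler_wpM2l ?mgfM.
  - move=> q; rewrite !inE => /or3P[/eqP->|/eqP->|/mapP[j + ->]] /=.
    + by rewrite !lexx ler01 z0.
    + by rewrite lexx z0 addr_ge0// !mulr_ge0 ?expR_ge0 ?sqrtr_ge0 ?addr_ge0.
    + rewrite mem_iota add1n ltnS => /andP[_ jz].
      have jlz : j%:R <= z.
        by apply: (@le_trans _ _ (Num.truncn z)%:R); rewrite ?ler_nat ?truncn_le.
      by rewrite !mulr_ge0 ?expR_ge0 ?sqrtr_ge0// ler0n jlz.
  split => //; apply: (le_trans b).
  by rewrite ler_wpM2l ?sum_weights_le// mulr_ge0 ?expR_ge0.
have [iV1 bV1] := hyp _ _ Hg1 g10 (fun t => mgf_V1 HX HF Hmean HG Hexp H1 (t := t)).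
have [iV2 bV2] := hyp _ _ Hg2 g20 (fun t => mgf_V2 HX HF Hdu Hexp H2 (t := t)).
pose K := 25 * M * (1 + z ^+ 2).
have mI : measurable_fun setT I.
  by apply/measurable_EFinP; exact: measurable_int (integrable_inner_Linv HX HF Hmean HG).
have if' : P.-integrable setT (EFin \o (fun x => fz' z (F x))).
  apply: le_integrable (L2_integrable1 (L2_cst (P := P) 1)) => //.
    by apply/measurable_EFinP; exact: measurableT_comp (measurable_fz' z) mF.
  by move=> x _; rewrite /= lee_fin /cst normr1 norm_fz'_le1.
have iFf : P.-integrable setT (EFin \o (fun x => F x * fz z (F x))).
  by apply: L2_integrable => //; case: D1.
have ihd : P.-integrable setT (EFin \o (fun x => hz z (F x) * du x)).
  by apply: L2_integrable; [case: (Hfz z)|case: Hdu].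
have mZ : measurable [set x | z < F x].
  rewrite -[X in measurable X]setTI; exact: measurable_fun_ltr.
have tail : \int[P]_x (if z < F x then 1 else 0) = fine (P [set x | z < F x]).
  rewrite /Rintegral; congr fine.
  transitivity (\int[P]_x (\1_[set x | z < F x] x)%:E)%E; last first.
    by rewrite integral_indic// setIT.
  apply: eq_integral => x _; rewrite indicE; case: ifPn => zx.
    by rewrite mem_set.
  by rewrite memNset//; exact/negP.
have itail : P.-integrable setT (EFin \o (fun x => if z < F x then 1 else 0 : R)).
  apply: le_integrable (L2_integrable1 (L2_cst (P := P) 1)) => //.
    apply/measurable_EFinP; apply: measurable_fun_ifT => //; exact: measurable_fun_ltr.
  by move=> x _; rewrite /= lee_fin /cst normr1; case: ifP; rewrite ?normr1 ?normr0.
have icst : P.-integrable setT (EFin \o cst c) by exact: L2_integrable1 (L2_cst c).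
have stein : \int[P]_x (fz' z (F x)) - \int[P]_x (F x * fz z (F x)) =
    c - fine (P [set x | z < F x]).
  rewrite -RintegralB// -tail.
  rewrite (@eq_Rintegral _ _ _ P setT (fun x => cst c x - (if z < F x then 1 else 0))); last first.
    by move=> x _; exact: fz'_stein.
  rewrite RintegralB// Rintegral_cst// [X in _ * fine X](@probability_setT _ _ _ P).
  by rewrite mulr1.
(* [weights_bound] supplies the factor [c], which the final division by [1 - Phi z] removes. *)
have B1 : `|\int[P]_x (fz' z (F x)) - \int[P]_x (fz' z (F x) * I x)| <=
    c * (gamma1 z * M * (25 * (1 + z ^+ 2))).
  rewrite -RintegralB//.
  have iB := integrableB measurableT if' iI.
  apply: (le_trans (le_normr_Rintegral measurableT iB)).
  apply: (@le_trans _ _ (\int[P]_x (c * (`|1 - I x| * gweight (weights z) (F x))))).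
    apply: le_Rintegral => //; first exact: integrable_norm iB.
      exact: (integrableZl measurableT c iV1).
    move=> x _; rewrite -[X in X - _]mulr1 -mulrBr normrM mulrCA mulrC.
    by rewrite ler_wpM2l//; case: (weights_bound (F x) z0).
  by rewrite RintegralZl// ler_wpM2l// ltW.
have B2 : \int[P]_x (hz z (F x) * du x) <= c * (gamma2 z * M * (25 * (1 + z ^+ 2))).
  apply: (@le_trans _ _ (\int[P]_x (c * (`|du x| * gweight (weights z) (F x))))).
    apply: le_Rintegral => //; first exact: (integrableZl measurableT c iV2).
    move=> x _; apply: (le_trans (ler_norm _)); rewrite normrM mulrCA mulrC.
    by rewrite ler_wpM2l//; case: (weights_bound (F x) z0).
  by rewrite RintegralZl// ler_wpM2l// ltW.
rewrite (_ : _ / c - 1 = - ((c - fine (P [set x | z < F x])) / c)); last first.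
  by field; rewrite gt_eqF.
rewrite normrN normrM normfV (gtr0_norm c0) ler_pdivrMr// -stein.
have -> : \int[P]_x (fz' z (F x)) - \int[P]_x (F x * fz z (F x)) =
  (\int[P]_x (fz' z (F x)) - \int[P]_x (fz' z (F x) * I x)) -
  (\int[P]_x (F x * fz z (F x)) - \int[P]_x (fz' z (F x) * I x)) by ring.
apply: (le_trans (ler_normB _ _)); apply: (le_trans (lerD B1 (le_trans rem B2))).
by rewrite le_eqVlt; apply/orP; left; apply/eqP; rewrite /M; ring.
Qed.
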